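(* Suppose Assumptions 1–7 hold. Then there exist constants $\delta>0$ and $\varepsilon>0$ such that if $d^2\log d\le\varepsilon N$, then choosing $\lambda=\delta\sqrt{\log(d+1)/N}$ in the penalized pseudolikelihood problem, the estimator $(\hat\beta,\hat{\bm\theta})$ satisfies $\|(\hat\beta-\beta,\hat{\bm\theta}^\top-\bm\theta^\top)\|_2=O\big(\sqrt{\log d/N}\big)$ with probability $1-o(1)$ as $N\to\infty$ and $d\to\infty$.
   Context: Given covariates $\bm Z_1,\dots,\bm Z_N\in\mathbb R^d$, a symmetric $N\times N$ matrix $\bm A$, $\beta\in\mathbb R$ and $\bm\theta\in\mathbb R^d$, the model is $\mathbb P_{\beta,\bm\theta}(\bm X=\bm x)\propto\exp\big(\bm\theta^\top\sum_{i=1}^Nx_i\bm Z_i+\frac\beta2\bm x^\top\bm A\bm x\big)$, $\bm x\in\{-1,1\}^N$. With $m_i(\bm X)=\sum_jA_{ij}X_j$, define $L_N(\tilde\beta,\tilde{\bm\theta})=\log2-\frac1N\sum_{i=1}^N\big[X_i(\tilde\beta m_i(\bm X)+\tilde{\bm\theta}^\top\bm Z_i)-\log\cosh(\tilde\beta m_i(\bm X)+\tilde{\bm\theta}^\top\bm Z_i)\big]$ and $(\hat\beta,\hat{\bm\theta})\in\arg\min_{(\tilde\beta,\tilde{\bm\theta})\in\mathbb R^{d+1}}L_N(\tilde\beta,\tilde{\bm\theta})+\lambda\|(\tilde\beta,\tilde{\bm\theta})\|_1$. Norms: $\|\bm M\|_\infty=\max_i\sum_j|M_{ij}|$, $\|\bm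 M\|_F$ Frobenius, $\|\bm a\|_0$ number of nonzero entries. Assumptions: (1) $\|\bm\theta\|_\infty<\Theta$ and $\|\bm Z_i\|_\infty<M$ for all $i$, for fixed constants $\Theta,M>0$; (2) $\bm A$ is symmetric with zero diagonal; (3) $\sup_N\|\bm A\|_\infty\le1$; (4) $\liminf_{N\to\infty}\frac1N\|\bm A\|_F^2>0$; (5) $|\beta|<1/4$; (6) $\liminf_{N\to\infty}\lambda_{\min}(N^{-1}\mathbf Z^\top\mathbf Z)>0$, where $\mathbf Z=(\bm Z_1,\dots,\bm Z_N)^\top$; (7) $s=\|(\beta,\bm\theta^\top)\|_0$ is bounded in $N$ and $d$. Here $\bm A$, $\bm Z_i$ and $d$ may depend on $N$. *)

(* Defs.v *)
From HB Require Import structures.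
From mathcomp Require Import all_boot all_order all_algebra.
From mathcomp Require Import all_classical all_reals all_analysis.
Set Implicit Arguments. Unset Strict Implicit. Unset Printing Implicit Defensive.
Import Order.TTheory GRing.Theory Num.Theory.
Local Open Scope ring_scope.

Section IsingDefs.
Variable R : realType.

Definition spin (b : bool) : R := if b then 1 else -1.

(* configurations x in {-1,1}^N *)
Definition config (N : nat) := {ffun 'I_N -> bool}.

Definition coshR (t : R) : R := (expR t + expR (- t)) / 2.

Definition lin_pred N d (Z : 'M[R]_(N, d)) (t : 'I_d -> R) (i : 'I_N) : R :=
  \sum_(k < d) t k * Z i k.

Definition mloc N (A : 'M[R]_N) (x : config N) (i : 'I_N) : R :=
  \sum_(j < N) A i j * spin (x j).

Definition ising_weight N d (A : 'M[R]_N) (Z : 'M[R]_(N, d)) (beta : R)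
  (theta : 'I_d -> R) (x : config N) : R :=
  expR ((\sum_(i < N) spin (x i) * lin_pred Z theta i)
        + beta / 2 * \sum_(i < N) \sum_(j < N) spin (x i) * A i j * spin (x j)).

Definition ising_prob N d (A : 'M[R]_N) (Z : 'M[R]_(N, d)) (beta : R)
  (theta : 'I_d -> R) (E : config N -> Prop) : R :=
  (\sum_(x : config N | `[< E x >]) ising_weight A Z beta theta x)
  / (\sum_(x : config N) ising_weight A Z beta theta x).

Definition pl_loss N d (A : 'M[R]_N) (Z : 'M[R]_(N, d)) (x : config N)
  (b : R) (t : 'I_d -> R) : R :=
  ln 2 - (N%:R)^-1 * \sum_(i < N)
    (spin (x i) * (b * mloc A x i + lin_pred Z t i)
     - ln (coshR (b * mloc A x i + lin_pred Z t i))).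

Definition l1norm d (b : R) (t : 'I_d -> R) : R := `|b| + \sum_(k < d) `|t k|.

Definition l2norm d (b : R) (t : 'I_d -> R) : R :=
  Num.sqrt (b ^+ 2 + \sum_(k < d) t k ^+ 2).

Definition l0norm d (b : R) (t : 'I_d -> R) : nat :=
  (b != 0) + #|[set k : 'I_d | t k != 0]|.

Definition is_pl_estimator N d (A : 'M[R]_N) (Z : 'M[R]_(N, d)) (x : config N)
  (lambda : R) (b : R) (t : 'I_d -> R) : Prop :=
  forall (b' : R) (t' : 'I_d -> R),
    pl_loss A Z x b t + lambda * l1norm b t
    <= pl_loss A Z x b' t' + lambda * l1norm b' t'.

Definition lambda_min n (M : 'M[R]_n) : R := inf [set a : R | eigenvalue M a].

End IsingDefs.

(* Main.v *)
Require Import Defs.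
From HB Require Import structures.
From mathcomp Require Import all_boot all_order all_algebra.
From mathcomp Require Import all_classical all_reals all_analysis.
From mathcomp Require Import ring lra.
Set Implicit Arguments. Unset Strict Implicit. Unset Printing Implicit Defensive.
Import Order.TTheory GRing.Theory Num.Theory numFieldNormedType.Exports.
Local Open Scope ring_scope.
Local Open Scope classical_set_scope.

(** The residuals [g_i = x_i - tanh (beta m_i + theta . Z_i)] satisfy an exact
    integration by parts: because the heat-bath weight is invariant under
    flipping spin [i], [E (g_i phi)] is an average of discrete derivatives of
    [phi] in direction [i]. It replaces all concentration inequalities for the
    Ising measure. Applied to [phi = exp (t sum_k z_k g_k)] it gives
    sub-Gaussian tails for the [theta]-gradient of the loss; applied to
    [phi = c_j(x) T(x)] it gives [E T^2 = O(N)] for [T = sum_j g_j (B x)_j] with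
    [B] symmetric, bounded and of zero diagonal.

    The second bound is used twice: with [B = A] for the [beta]-gradient, and
    with [B] the off-diagonal part of [A Q A], [Q] being the projection
    orthogonal to the columns of [Z]. Since [g_j x_j] is bounded below, the
    diagonal part of [g^T A Q A x] is at least a multiple of
    [tr (A Q A) >= ||A||_F^2 - d], so that [m = A x] stays at distance of order
    [sqrt N] from the column space of [Z], whence a lower bound for the Gram
    matrix of [(m, Z)]. The Lasso basic inequality, the cone condition, and the
    bound [c h^2 / (1 + |h|)] on the Bregman divergence of [ln cosh] then give
    the rate without a localization step. *)

(** * The Bregman divergence of [ln cosh] *)

Section Tanh.
Variable R : realType.
Implicit Types (a b h t p q : R).

Definition tanhR t : R := (expR t - expR (- t)) / (expR t + expR (- t)).

Lemma tanhRN t : tanhR (- t) = - tanhR t.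
Proof. by rewrite /tanhR opprK -mulNr opprB [X in _ / X]addrC. Qed.

Lemma expRD_gt0 t : 0 < expR t + expR (- t).
Proof. by rewrite addr_gt0 // expR_gt0. Qed.

Lemma coshR_gt0 t : 0 < coshR t.
Proof. by rewrite /coshR divr_gt0 // expRD_gt0. Qed.

Lemma one_subr_tanhR t : 1 - tanhR t = 2 * expR (- t) / (expR t + expR (- t)).
Proof. rewrite /tanhR; field; exact: lt0r_neq0 (expRD_gt0 t). Qed.

Lemma one_addr_tanhR t : 1 + tanhR t = 2 * expR t / (expR t + expR (- t)).
Proof. rewrite /tanhR; field; exact: lt0r_neq0 (expRD_gt0 t). Qed.

Lemma tanhR_norm_lt1 t : `|tanhR t| < 1.
Proof.
have h1 : 0 < 1 - tanhR t.
  by rewrite one_subr_tanhR divr_gt0 ?expRD_gt0 // mulr_gt0 // expR_gt0.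
have h2 : 0 < 1 + tanhR t.
  by rewrite one_addr_tanhR divr_gt0 ?expRD_gt0 // mulr_gt0 // expR_gt0.
rewrite ltr_norml; lra.
Qed.

Lemma tanhR_gap_half (H t : R) : `|t| <= H -> expR (- (2 * H)) <= 1 - tanhR t.
Proof.
move=> tH; rewrite one_subr_tanhR ler_pdivlMr ?expRD_gt0 //.
have [t1 t2] : - H <= t /\ t <= H by move: tH; rewrite ler_norml => /andP.
have e1 : expR t <= expR H by rewrite ler_expR.
have e2 : expR (- t) <= expR H by rewrite ler_expR; lra.
have e3 : expR (- H) <= expR (- t) by rewrite ler_expR; lra.
have e4 : expR (- (2 * H)) * expR H = expR (- H).
  by rewrite -expRD; congr expR; ring.
have e5 := expR_gt0 (- (2 * H)).
have : expR (- (2 * H)) * (expR t + expR (- t))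
  <= expR (- (2 * H)) * (expR H + expR H) by rewrite ler_pM2l // lerD.
lra.
Qed.

(** A spin whose field is bounded by [H] takes each of its two values with probability bounded away
    from zero. *)
Lemma tanhR_gap (H t : R) : `|t| <= H -> expR (- (2 * H)) <= 1 - `|tanhR t|.
Proof.
move=> tH; have h1 := tanhR_gap_half tH.
have h2 : expR (- (2 * H)) <= 1 - tanhR (- t) by apply: tanhR_gap_half; rewrite normrN.
rewrite tanhRN in h2.
by case: (ger0P (tanhR t)) => ?; lra.
Qed.

(** Over the common denominator the difference is [2 e^(a-b) (1 - e^(-2(a-b)))] divided by a product
    that is at least [e^(a-b)]. The constant 4 is crude, but [|beta| <= 1/4] absorbs it in
    [tau_diff]. *)
Lemma tanhR_lip a b : `|tanhR a - tanhR b| <= 4 * `|a - b|.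
Proof.
wlog ba : a b / b <= a.
  move=> W; case/orP: (le_total b a) => /W //.
  by rewrite distrC [`|b - a|]distrC.
have E t : tanhR t = 1 - 2 * expR (- t) / (expR t + expR (- t)).
  by rewrite -one_subr_tanhR; ring.
have ea := expR_gt0 a; have eb := expR_gt0 b.
have ena := expR_gt0 (- a); have enb := expR_gt0 (- b).
have -> : tanhR a - tanhR b =
  2 * (expR a * expR (- b) - expR (- a) * expR b) /
  ((expR a + expR (- a)) * (expR b + expR (- b))).
  by rewrite /tanhR; field; rewrite !lt0r_neq0 // ?expRD_gt0.
rewrite [X in _ <= _ * X]ger0_norm ?subr_ge0 //.
have m : expR (- a) * expR b <= expR a * expR (- b).
  by rewrite -!expRD ler_expR; lra.
have P : 0 < (expR a + expR (- a)) * (expR b + expR (- b)).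
  by rewrite mulr_gt0 // expRD_gt0.
rewrite ger0_norm; last by rewrite divr_ge0 ?(ltW P) // mulr_ge0 // subr_ge0.
rewrite ler_pdivrMr //.
have k : expR a * expR (- b) - expR (- a) * expR b <= expR a * expR (- b) * (2 * (a - b)).
  have -> : expR (- a) * expR b = expR a * expR (- b) * expR (- (2 * (a - b))).
    by rewrite -!expRD; congr expR; ring.
  rewrite -{1}[expR a * expR (- b)]mulr1 -mulrBr ler_wpM2l ?mulr_ge0 ?expR_ge0 //.
  have := expR_ge1Dx (- (2 * (a - b))); lra.
have k2 : expR a * expR (- b) <= (expR a + expR (- a)) * (expR b + expR (- b)).
  rewrite mulrDl !mulrDr; have := mulr_ge0 (ltW ea) (ltW eb).
  have := mulr_ge0 (ltW ena) (ltW eb); have := mulr_ge0 (ltW ena) (ltW enb); lra.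
have k3 : expR a * expR (- b) * (2 * (a - b)) <= (expR a + expR (- a)) * (expR b + expR (- b)) * (2 * (a - b)).
  apply: ler_wpM2r => //; lra.
lra.
Qed.

(* [lncosh_bregman a h = ln (p e^{2qh} + q e^{-2ph})] with [p = (1 + tanh a) / 2] and [q = 1 - p];
   both weights are bounded below as long as [a] is bounded. *)
Definition lncosh_bregman a h : R :=
  ln (coshR (a + h)) - ln (coshR a) - h * tanhR a.

(** For [0 <= h], squaring the tangent bound of [exp (q h)] bounds the first exponential with a
    quadratic gain, and the tangent line bounds the second. The linear terms cancel and [p q^2 h^2]
    remains. The other sign of [h] exchanges [p] and [q]. *)
Lemma exp_mix_lower p q (r h : R) : p + q = 1 -> 0 <= r -> r <= p -> r <= q ->
  1 + r ^+ 3 * h ^+ 2 <= p * expR (2 * q * h) + q * expR (- (2 * p * h)).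
Proof.
wlog h0 : p q h / 0 <= h.
  move=> W pq r0 rp rq; case: (lerP 0 h) => [h0|/ltW h0]; first exact: W.
  have := W q p (- h); rewrite addrC sqrrN oppr_ge0 => /(_ h0 pq r0 rq rp).
  by rewrite !mulrN opprK [X in _ <= X]addrC.
move=> pq r0 rp rq.
have q0 : 0 <= q := le_trans r0 rq.
have p0 : 0 <= p := le_trans r0 rp.
have e1 : 1 - 2 * p * h <= expR (- (2 * p * h)) by have := expR_ge1Dx (- (2 * p * h)); lra.
have e2 : (1 + q * h) ^+ 2 <= expR (2 * q * h).
  have -> : expR (2 * q * h) = expR (q * h) ^+ 2.
    by rewrite expr2 -expRD; congr expR; ring.
  rewrite lerXn2r ?nnegrE ?expR_ge0 //; last exact: expR_ge1Dx.
  by rewrite addr_ge0 // mulr_ge0.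
have e3 : p * (1 + q * h) ^+ 2 <= p * expR (2 * q * h) by rewrite ler_wpM2l.
have e4 : q * (1 - 2 * p * h) <= q * expR (- (2 * p * h)) by rewrite ler_wpM2l.
apply: le_trans (lerD e3 e4).
have -> : p * (1 + q * h) ^+ 2 + q * (1 - 2 * p * h) = (p + q) + p * q ^+ 2 * h ^+ 2 by ring.
rewrite pq lerD2l ler_wpM2r ?sqr_ge0 //.
rewrite exprS ler_pM ?sqr_ge0 // lerXn2r ?nnegrE //.
Qed.

Lemma lncosh_bregman_ln a h (r : R) : 0 <= r -> 2 * r <= 1 - `|tanhR a| ->
  ln (1 + r ^+ 3 * h ^+ 2) <= lncosh_bregman a h.
Proof.
move=> r0 ra.
set p := (1 + tanhR a) / 2; set q := (1 - tanhR a) / 2.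
have pq : p + q = 1 by rewrite /p /q; field.
have [ta1 ta2] : tanhR a <= `|tanhR a| /\ - tanhR a <= `|tanhR a|.
  by rewrite ler_norm -normrN ler_norm.
have rp : r <= p by rewrite /p; lra.
have rq : r <= q by rewrite /q; lra.
have E : lncosh_bregman a h = ln (p * expR (2 * q * h) + q * expR (- (2 * p * h))).
  have mixE : p * expR (2 * q * h) + q * expR (- (2 * p * h)) =
     coshR (a + h) / coshR a * expR (- (h * tanhR a)).
    have -> : expR (2 * q * h) = expR h * expR (- (h * tanhR a)).
      by rewrite -expRD; congr expR; rewrite /q; field.
    have -> : expR (- (2 * p * h)) = expR (- h) * expR (- (h * tanhR a)).
      by rewrite -expRD; congr expR; rewrite /p; field.
    rewrite !mulrA -mulrDl; congr (_ * _).
    rewrite /p /q one_subr_tanhR one_addr_tanhR /coshR opprD !expRD.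
    by field; rewrite lt0r_neq0 // expRD_gt0.
  rewrite mixE /lncosh_bregman -[in LHS](expRK (h * tanhR a)) expRN.
  have P1 := coshR_gt0 a; have P2 := coshR_gt0 (a + h).
  have L (u v y : R) : 0 < u -> 0 < v -> 0 < y -> ln (u / v / y) = ln u - ln v - ln y.
    by move=> *; rewrite !ln_div ?posrE ?divr_gt0.
  by rewrite L ?expR_gt0.
rewrite E.
have le := exp_mix_lower h pq r0 rp rq.
have gt : 0 < 1 + r ^+ 3 * h ^+ 2.
  by rewrite ltr_pwDl // mulr_ge0 ?sqr_ge0 ?exprn_ge0.
by rewrite ler_ln ?posrE //; exact: lt_le_trans le.
Qed.

Lemma lncosh_bregman_ge0 a h : 0 <= lncosh_bregman a h.
Proof.
have := @lncosh_bregman_ln a h 0 (lexx _).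
rewrite expr0n /= mul0r addr0 ln1; apply.
by rewrite mulr0 subr_ge0 ltW // tanhR_norm_lt1.
Qed.

(** This is convexity in [h]: the divergences from the intermediate point [a + t h] to both end
    points are nonnegative, and averaging them with weights [t] and [1 - t] cancels the slope at
    that point. *)
Lemma lncosh_bregman_scale a h t : 0 <= t -> t <= 1 ->
  lncosh_bregman a (t * h) <= t * lncosh_bregman a h.
Proof.
move=> t0 t1.
have h1 := lncosh_bregman_ge0 (a + t * h) ((1 - t) * h).
have h2 := lncosh_bregman_ge0 (a + t * h) (- (t * h)).
rewrite /lncosh_bregman in h1 h2 *.
rewrite addrK in h2.
have E : a + t * h + (1 - t) * h = a + h by ring.
rewrite E in h1.
have h3 := mulr_ge0 t0 h1.
have t1' : 0 <= 1 - t by lra.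
have h4 := mulr_ge0 t1' h2.
set x := ln (coshR (a + t * h)) in h3 h4 *; set y := ln (coshR (a + h)) in h3 *.
set z := ln (coshR a) in h4 *; set T := tanhR (a + t * h) in h3 h4 *.
have : t * (y - x - (1 - t) * h * T) + (1 - t) * (z - x - - (t * h) * T) =
  t * y + (1 - t) * z - x by ring.
lra.
Qed.

Lemma ln1D_lower (x : R) : 0 <= x -> x / (1 + x) <= ln (1 + x).
Proof.
move=> x0; have P : 0 < 1 + x by lra.
have := expR_ge1Dx (- ln (1 + x)); rewrite expRN lnK ?posrE //.
have E : (1 + x)^-1 = 1 - x / (1 + x) by field; exact: lt0r_neq0.
by rewrite {1}E lerD2l lerN2.
Qed.

(** The bound of [lncosh_bregman_ln] is quadratic only for bounded increments. It is applied to
    [h / (1 + |h|)], which lies in [[-1, 1]], and convexity carries it back to [h]. The result grows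
    linearly for large [h], as the divergence itself does. *)
Lemma lncosh_bregman_lower a h (r : R) : 0 <= r -> r <= 1 -> 2 * r <= 1 - `|tanhR a| ->
  r ^+ 3 / 2 * (h ^+ 2 / (1 + `|h|)) <= lncosh_bregman a h.
Proof.
move=> r0 r1 ra; set s := 1 + `|h|.
have s0 : 0 < s by rewrite /s ltr_pwDl.
have t0 : 0 <= s^-1 by rewrite invr_ge0 ltW.
have t1 : s^-1 <= 1 by rewrite invf_le1 // /s lerDl.
have := lncosh_bregman_scale a h t0 t1.
have := @lncosh_bregman_ln a (s^-1 * h) r r0 ra.
set k := r ^+ 3; set u := s^-1 * h.
have u1 : u ^+ 2 <= 1.
  rewrite -[u ^+ 2]ger0_norm ?sqr_ge0 // normrX expr_le1 //.
  by rewrite /u normrM gtr0_norm ?invr_gt0 // mulrC ler_pdivrMr // mul1r /s lerDr.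
have k0 : 0 <= k by rewrite exprn_ge0.
have k1 : k <= 1 by rewrite exprn_ile1.
have ku0 : 0 <= k * u ^+ 2 by rewrite mulr_ge0 // sqr_ge0.
have ku1 : k * u ^+ 2 <= 1 by rewrite mulr_ile1 // sqr_ge0.
have := ln1D_lower ku0.
have l1 : k * u ^+ 2 / 2 <= k * u ^+ 2 / (1 + k * u ^+ 2).
  by rewrite ler_wpM2l // lef_pV2 ?posrE; lra.
move=> l2 l3 l4.
have l5 : k * u ^+ 2 / 2 <= s^-1 * lncosh_bregman a h by lra.
have -> : k / 2 * (h ^+ 2 / s) = s * (k * u ^+ 2 / 2) by rewrite /u; field; exact: lt0r_neq0.
by rewrite -ler_pdivlMl.
Qed.

End Tanh.

(** * Integration by parts for spin systems *)

Definition flip N (x : config N) (i : 'I_N) : config N :=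
  [ffun j => if j == i then ~~ x j else x j].

Lemma flipK N (i : 'I_N) : involutive (fun x : config N => flip x i).
Proof. by move=> x; apply/ffunP => j; rewrite !ffunE; case: eqP => // _; rewrite negbK. Qed.

Lemma spinN (R : realType) (b : bool) : spin R (~~ b) = - spin R b.
Proof. by case: b; rewrite /spin /= ?opprK. Qed.

Lemma spin_sqr (R : realType) (b : bool) : spin R b * spin R b = 1.
Proof. by case: b; rewrite /spin /= ?mulrNN mulr1. Qed.

Lemma spin_norm (R : realType) (b : bool) : `|spin R b| = 1.
Proof. by case: b; rewrite /spin /= ?normrN normr1. Qed.

Lemma spin_flip (R : realType) N (x : config N) i : spin R (flip x i i) = - spin R (x i).
Proof. by rewrite ffunE eqxx spinN. Qed.

Lemma mloc_flip (R : realType) N (B : 'M[R]_N) (x : config N) j k :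
  mloc B x k - mloc B (flip x j) k = 2 * (B k j * spin R (x j)).
Proof.
rewrite /mloc -sumrB (bigD1 j) //= big1 ?addr0.
  by rewrite spin_flip; ring.
by move=> i /negPf ij; rewrite ffunE ij subrr.
Qed.

(** The right side is symmetric in [x] and [y], so that after summation against a flip-invariant
    weight both exponentials contribute the same. *)
Lemma expR_diff_le (R : realType) (x y : R) :
  `|expR x - expR y| <= `|x - y| * (expR x + expR y).
Proof.
wlog yx : x y / y <= x.
  move=> W; case/orP: (le_total y x) => /W //.
  by rewrite distrC [`|y - x|]distrC [expR y + _]addrC.
rewrite !ger0_norm ?subr_ge0 ?ler_expR //.
have -> : expR y = expR x * expR (- (x - y)) by rewrite -expRD; congr expR; ring.
have := expR_ge1Dx (- (x - y)) => h.
have e := expR_gt0 x; have e2 := expR_gt0 (- (x - y)).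
have : expR x * (1 - expR (- (x - y))) <= expR x * (x - y) by rewrite ler_pM2l //; lra.
have : 0 <= (x - y) * (expR x * expR (- (x - y))).
  by rewrite mulr_ge0 ?subr_ge0 // mulr_ge0 ?expR_ge0.
rewrite mulrBr mulrDr; lra.
Qed.

(** By [2 |c j| |c k| <= c j ^ 2 + c k ^ 2], the row sums control one half and the column sums the
    other. *)
Lemma schur_test (R : realType) (I : finType) (e : I -> I -> R) (r : R) (c : I -> R) :
  (forall j k, 0 <= e j k) ->
  (forall j, \sum_k e j k <= r) -> (forall k, \sum_j e j k <= r) ->
  \sum_j \sum_k e j k * (`|c j| * `|c k|) <= r * \sum_j c j ^+ 2.
Proof.
move=> e0 er ec.
have -> : r * \sum_j c j ^+ 2 = \sum_j (r * c j ^+ 2) / 2 + \sum_j (r * c j ^+ 2) / 2.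
  by rewrite -mulr_suml -mulr_sumr; field.
apply: (@le_trans _ _ (\sum_j \sum_k (e j k * (c j ^+ 2) / 2) + \sum_j \sum_k (e j k * (c k ^+ 2) / 2))).
  rewrite -big_split /=; apply: ler_sum => j _; rewrite -big_split /=.
  apply: ler_sum => k _; rewrite -mulrDl -mulrDr -mulrA ler_wpM2l //.
  have := sqr_ge0 (`|c j| - `|c k|); rewrite sqrrB !real_normK ?num_real //; lra.
apply: lerD.
  apply: ler_sum => j _; rewrite -!mulr_suml -mulrA -[X in _ <= X]mulrA ler_wpM2r ?er //.
  by rewrite divr_ge0 ?sqr_ge0.
rewrite exchange_big; apply: ler_sum => j _; rewrite -!mulr_suml -mulrA -[X in _ <= X]mulrA ler_wpM2r ?ec //.
by rewrite divr_ge0 ?sqr_ge0.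
Qed.

Lemma is_derive_bigsum (R : realType) (I : Type) (r : seq I) (f : I -> R -> R) (df : I -> R) (s : R) :
  (forall x, is_derive s (1 : R) (f x) (df x)) ->
  is_derive s (1 : R) (fun t => \sum_(x <- r) f x t) (\sum_(x <- r) df x).
Proof.
move=> h; elim: r => [|x r IH].
  have -> : (fun t => \sum_(x <- [::]) f x t) = cst 0 by apply/funext => t; rewrite big_nil.
  rewrite big_nil; exact: is_derive_cst.
have -> : (fun t => \sum_(y <- x :: r) f y t) = f x + (fun t => \sum_(y <- r) f y t).
  by apply/funext => t; rewrite big_cons.
rewrite big_cons; exact: is_deriveD.
Qed.

(* A spin system seen through its single-site conditional means [tau x i]:
   [balance] is reversibility of the heat-bath dynamics. *)
Section Glauber.
Variables (R : realType) (N : nat) (w : config N -> R).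
Variables (tau : config N -> 'I_N -> R) (a : 'I_N -> 'I_N -> R).
Hypothesis w_ge0 : forall x, 0 <= w x.
Hypothesis tau_le1 : forall x i, `|tau x i| <= 1.
Hypothesis tau_flip : forall x i, tau (flip x i) i = tau x i.
Hypothesis balance : forall x i,
  w x * (1 - spin R (x i) * tau x i) = w (flip x i) * (1 + spin R (x i) * tau x i).
Hypothesis a_ge0 : forall j k, 0 <= a j k.
Hypothesis a_row : forall j, \sum_k a j k <= 1.
Hypothesis a_col : forall k, \sum_j a j k <= 1.
Hypothesis tau_diff : forall x j k, `|tau x k - tau (flip x j) k| <= 2 * a k j.

Local Notation sp x i := (spin R (x i)).

Definition resid (x : config N) (i : 'I_N) : R := sp x i - tau x i.

(** Twice the conductance of the edge between [x] and [flip x i] in the heat-bath dynamics: the flip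
    probability is [(1 - x_i tau_i) / 2]. *)
Definition edge (x : config N) (i : 'I_N) : R := w x * (1 - sp x i * tau x i).

Lemma edge_flip x i : edge (flip x i) i = edge x i.
Proof. by rewrite /edge tau_flip spin_flip mulNr opprK -balance. Qed.

Lemma spin_tau_le (x : config N) i : `|sp x i * tau x i| <= 1.
Proof. by rewrite normrM spin_norm mul1r. Qed.

Lemma edge_ge0 x i : 0 <= edge x i.
Proof.
rewrite mulr_ge0 // subr_ge0; exact: le_trans (ler_norm _) (spin_tau_le x i).
Qed.

Lemma edge_le x i : edge x i <= 2 * w x.
Proof.
rewrite /edge mulrC ler_wpM2r //; have := spin_tau_le x i.
by rewrite ler_norml => /andP[]; lra.
Qed.

Lemma resid_le2 x i : `|resid x i| <= 2.
Proof. by rewrite (le_trans (ler_normB _ _)) // spin_norm; have := tau_le1 x i; lra. Qed.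

Lemma sum_flip (F : config N -> R) i : \sum_x F (flip x i) = \sum_x F x.
Proof. by rewrite [RHS](reindex_inj (inv_inj (@flipK N i))). Qed.

(** Reindexing by the flip preserves [edge] and negates the spin, so the two halves of the
    right-hand difference are equal. Then [x_i (1 - x_i tau_i) = x_i - tau_i] recovers the
    residual. *)
Lemma resid_ibp i (phi : config N -> R) :
  \sum_x w x * (resid x i * phi x) =
  2^-1 * \sum_x edge x i * (sp x i * (phi x - phi (flip x i))).
Proof.
have E : \sum_x edge x i * (sp x i * phi (flip x i)) = - \sum_x edge x i * (sp x i * phi x).
  rewrite -[in RHS](sum_flip _ i) -sumrN; apply: eq_bigr => x _.
  by rewrite edge_flip spin_flip mulNr mulrN opprK.
have -> : \sum_x edge x i * (sp x i * (phi x - phi (flip x i))) =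
   \sum_x edge x i * (sp x i * phi x) - \sum_x edge x i * (sp x i * phi (flip x i)).
  by rewrite -sumrB; apply: eq_bigr => x _; ring.
rewrite E opprK -mulr2n -[X in _ * X]mulr_natl mulKf ?pnatr_eq0 //.
apply: eq_bigr => x _; rewrite /edge /resid.
have -> : sp x i - tau x i = sp x i * 1 - (sp x i * sp x i) * tau x i by rewrite spin_sqr; ring.
ring.
Qed.

(** Bounds the change of residual [k] when spin [j] is flipped: the spin itself moves only for
    [k = j], its conditional mean by at most [2 a k j]. It plays the role of a Dobrushin
    interdependence matrix. *)
Definition influence (j k : 'I_N) : R := 2 * (k == j)%:R + 2 * a k j.

Lemma influence_ge0 j k : 0 <= influence j k.
Proof. by rewrite addr_ge0 // mulr_ge0 // ler0n. Qed.

Lemma influence_row j : \sum_k influence j k <= 4.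
Proof.
rewrite big_split /= -!mulr_sumr (bigD1 j) //= eqxx big1 => [|k /negPf-> //].
by rewrite mulr1n; have := a_col j; lra.
Qed.

Lemma influence_col k : \sum_j influence j k <= 4.
Proof.
rewrite big_split /= -!mulr_sumr (bigD1 k) //= eqxx big1 => [|j]; last by rewrite eq_sym => /negPf->.
by rewrite mulr1n; have := a_row k; lra.
Qed.

Lemma resid_diff x j k : `|resid x k - resid (flip x j) k| <= influence j k.
Proof.
rewrite /resid /influence.
have -> : sp x k - tau x k - (spin R (flip x j k) - tau (flip x j) k) =
  (sp x k - spin R (flip x j k)) - (tau x k - tau (flip x j) k) by ring.
apply: le_trans (ler_normB _ _) _; apply: lerD (tau_diff x j k).
rewrite ffunE; case: eqP => _; last by rewrite subrr normr0 mulr0.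
rewrite spinN opprK (le_trans (ler_normD _ _)) // spin_norm mulr1n; lra.
Qed.

(** * Sub-Gaussian tails for linear statistics of the residuals *)

Section LinearStatistic.
Variables (z : 'I_N -> R) (M : R).
Hypothesis zM : forall i, `|z i| <= M.
Hypothesis M_ge0 : 0 <= M.

Definition linstat x : R := \sum_i z i * resid x i.

Lemma linstat_diff x j : `|linstat x - linstat (flip x j)| <= 4 * M.
Proof.
rewrite /linstat -sumrB (le_trans (ler_norm_sum _ _ _)) //.
apply: (@le_trans _ _ (\sum_k M * influence j k)).
  apply: ler_sum => k _; rewrite -mulrBr normrM ler_pM //; exact: resid_diff.
by rewrite -mulr_sumr mulrC ler_wpM2r // influence_row.
Qed.

(** Integration by parts for [phi = exp (t * linstat)]. The exponent moves by at most [4 M t] under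
    a flip, the two exponentials of [expR_diff_le] have equal sums, and [edge <= 2 w]. *)
Lemma resid_exp_bound t i : 0 <= t ->
  `|\sum_x w x * (resid x i * expR (t * linstat x))| <=
  t * (8 * M) * \sum_x w x * expR (t * linstat x).
Proof.
move=> t0; rewrite resid_ibp normrM gtr0_norm ?invr_gt0 //.
rewrite ler_pdivrMl //.
apply: le_trans (ler_norm_sum _ _ _) _.
have S : \sum_x edge x i * expR (t * linstat (flip x i)) = \sum_x edge x i * expR (t * linstat x).
  by rewrite -[RHS](sum_flip _ i); apply: eq_bigr => x _; rewrite edge_flip.
apply: (@le_trans _ _ (\sum_x t * (4 * M) * (edge x i * expR (t * linstat x) + edge x i * expR (t * linstat (flip x i))))).
  apply: ler_sum => x _; rewrite normrM (ger0_norm (edge_ge0 _ _)) normrM spin_norm mul1r.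
  rewrite -mulrDr mulrCA ler_wpM2l ?edge_ge0 //.
  apply: le_trans (expR_diff_le _ _) _.
  rewrite -mulrBr normrM (ger0_norm t0) ler_wpM2r ?addr_ge0 ?expR_ge0 //.
  by rewrite ler_wpM2l // linstat_diff.
rewrite -mulr_sumr big_split /= S.
have : \sum_x edge x i * expR (t * linstat x) <= \sum_x 2 * (w x * expR (t * linstat x)).
  by apply: ler_sum => x _; rewrite mulrA ler_wpM2r ?expR_ge0 ?edge_le.
rewrite -mulr_sumr => h.
have tm : 0 <= t * (4 * M) by rewrite !mulr_ge0.
have := ler_wpM2l tm h; lra.
Qed.

(** For the unnormalized moment generating function [F] this is the differential inequality
    [F' <= 2 C t F] with [C = 4 M^2 N], which the next lemma integrates. *)
Lemma linstat_exp_bound t : 0 <= t ->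
  \sum_x w x * (linstat x * expR (t * linstat x)) <=
  8 * M ^+ 2 * N%:R * t * \sum_x w x * expR (t * linstat x).
Proof.
move=> t0.
have -> : \sum_x w x * (linstat x * expR (t * linstat x)) =
   \sum_i z i * \sum_x w x * (resid x i * expR (t * linstat x)).
  under [RHS]eq_bigr => i _ do rewrite mulr_sumr.
  rewrite exchange_big /=; apply: eq_bigr => x _.
  rewrite {1}/linstat mulr_suml mulr_sumr; apply: eq_bigr => i _; ring.
apply: (@le_trans _ _ (\sum_(i < N) M * (t * (8 * M) * \sum_x w x * expR (t * linstat x)))).
  apply: ler_sum => i _; apply: le_trans (ler_norm _) _; rewrite normrM ler_pM //.
  exact: resid_exp_bound.
rewrite sumr_const card_ord -mulr_natr le_eqVlt; apply/orP; left; apply/eqP; ring.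
Qed.

Lemma linstat_mgf t : 0 <= t ->
  \sum_x w x * expR (t * linstat x) <=
  expR (4 * M ^+ 2 * N%:R * t ^+ 2) * \sum_x w x.
Proof.
move=> t0; set C := 4 * M ^+ 2 * N%:R.
(* [G] is the moment generating function divided by the expected Gaussian bound; it is nonincreasing
   on [s >= 0]. *)
pose G (s : R) := \sum_x w x * expR (s * linstat x - C * s ^+ 2).
pose dG (s : R) := \sum_x w x * ((linstat x - C * (2 * s)) * expR (s * linstat x - C * s ^+ 2)).
have GE s : G s = expR (- (C * s ^+ 2)) * \sum_x w x * expR (s * linstat x).
  rewrite mulr_sumr; apply: eq_bigr => x _; rewrite expRD; ring.
have dGE s : dG s = expR (- (C * s ^+ 2)) *
   (\sum_x w x * (linstat x * expR (s * linstat x)) - C * (2 * s) * \sum_x w x * expR (s * linstat x)).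
  rewrite mulr_sumr -sumrB mulr_sumr; apply: eq_bigr => x _; rewrite expRD; ring.
have dGle s : 0 <= s -> dG s <= 0.
  move=> s0; rewrite dGE mulr_ge0_le0 ?expR_ge0 // subr_le0.
  have -> : C * (2 * s) = 8 * M ^+ 2 * N%:R * s by rewrite /C; ring.
  exact: linstat_exp_bound.
have GD (s : R) : is_derive s 1 G (dG s).
  apply: is_derive_bigsum => x.
  apply: is_derive_eq.
  rewrite /GRing.scale /=; ring.
have G0 : G 0 = \sum_x w x.
  by apply: eq_bigr => x _; rewrite mul0r expr0n /= mulr0 subr0 expR0 mulr1.
suff : G t <= G 0.
  rewrite G0 GE => h.
  have := ler_wpM2l (expR_ge0 (C * t ^+ 2)) h; rewrite mulrA -expRD subrr expR0 mul1r; exact.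
have [//|] := @MVT_segment R G dG 0 t t0.
  by apply: derivable_within_continuous => s _; exact: ex_derive.
move=> s; rewrite in_itv /= => /andP[s0 _]; rewrite subr0 => E.
rewrite -subr_le0 E mulr_le0_ge0 // dGle //.
Qed.

Lemma linstat_tail (u : R) : 0 < M -> (0 < N)%N -> 0 <= u ->
  \sum_(x | u <= linstat x) w x <= expR (- (u ^+ 2 / (16 * M ^+ 2 * N%:R))) * \sum_x w x.
Proof.
move=> M0 N0 u0; set K := 16 * M ^+ 2 * N%:R.
have K0 : 0 < K by rewrite !mulr_gt0 ?exprn_gt0 ?ltr0n.
(* This [t] maximizes the Chernoff exponent [t u - 4 M^2 N t^2]. *)
set t := 2 * u / K.
have t0 : 0 <= t by rewrite divr_ge0 ?(ltW K0) // mulr_ge0.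
have h : \sum_(x | u <= linstat x) w x <= expR (- (t * u)) * \sum_x w x * expR (t * linstat x).
  rewrite mulr_sumr [X in _ <= X](bigID (fun x => u <= linstat x)) /=.
  rewrite -[X in X <= _]addr0; apply: lerD; last first.
    by apply: sumr_ge0 => x _; rewrite !mulr_ge0 ?expR_ge0.
  apply: ler_sum => x ux; rewrite mulrCA -expRD -[X in X <= _]mulr1 ler_wpM2l //.
  by rewrite -expR0 ler_expR addrC subr_ge0 ler_wpM2l.
apply: le_trans h _; apply: le_trans (ler_wpM2l (expR_ge0 _) (linstat_mgf t0)) _.
rewrite mulrA -expRD ler_wpM2r ?sumr_ge0 // ler_expR le_eqVlt; apply/orP; left; apply/eqP.
have N1 : N%:R != 0 :> R by rewrite pnatr_eq0 -lt0n.
by rewrite /t /K; field; rewrite N1 lt0r_neq0.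
Qed.

End LinearStatistic.

(** * Second moments of quadratic statistics of residuals and spins *)

Section QuadraticStatistic.
Variable B : 'M[R]_N.
Hypothesis B_sym : forall j k, B j k = B k j.
Hypothesis B_diag : forall j, B j j = 0.
Hypothesis B_le : forall j k, `|B j k| <= 2.
Hypothesis B_op : forall v : 'I_N -> R, \sum_j (\sum_k B j k * v k) ^+ 2 <= 4 * \sum_k v k ^+ 2.

Definition quadstat x : R := \sum_j resid x j * mloc B x j.

Lemma sum_mloc_sqr x : \sum_j mloc B x j ^+ 2 <= 4 * N%:R.
Proof.
apply: le_trans (B_op (fun k => sp x k)) _; rewrite ler_wpM2l //.
under eq_bigr => k _ do rewrite expr2 spin_sqr.
by rewrite sumr_const card_ord.
Qed.

(** Discrete product rule: the change of the residuals, the change of [B x], and a cross term. The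
    cross term is at most [2 * 2 * 4 = 16], from the entries of [B] and the row sums of
    [influence]. *)
Lemma quadstat_diff x j : `|quadstat x - quadstat (flip x j)| <=
  \sum_k influence j k * `|mloc B x k| + 2 * `|\sum_k B j k * resid x k| + 16.
Proof.
pose D k := resid x k - resid (flip x j) k.
have -> : quadstat x - quadstat (flip x j) =
  \sum_k D k * mloc B x k + 2 * sp x j * (\sum_k B j k * resid x k) - 2 * sp x j * (\sum_k B j k * D k).
  rewrite /quadstat -sumrB !mulr_sumr -big_split -sumrB; apply: eq_bigr => k _ /=.
  have -> : mloc B (flip x j) k = mloc B x k - 2 * (B j k * sp x j) by rewrite (B_sym j k) -mloc_flip; ring.
  rewrite /D; ring.
apply: le_trans (ler_normB _ _) _; apply: lerD.
  apply: le_trans (ler_normD _ _) _; apply: lerD.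
    apply: le_trans (ler_norm_sum _ _ _) _; apply: ler_sum => k _.
    by rewrite normrM ler_wpM2r // resid_diff.
  by rewrite !normrM spin_norm mulr1 gtr0_norm.
rewrite !normrM spin_norm mulr1 gtr0_norm //.
have : `|\sum_k B j k * D k| <= \sum_k 2 * influence j k.
  apply: le_trans (ler_norm_sum _ _ _) _; apply: ler_sum => k _.
  by rewrite normrM ler_pM // resid_diff.
rewrite -mulr_sumr; have := influence_row j; lra.
Qed.

(** One factor of the square is expanded into residuals and integrated by parts. Its coefficient
    [mloc B x j] is blind to spin [j], as [B] has zero diagonal, so only the other factor is
    differentiated. *)
Lemma quadstat_second_moment : \sum_x w x * quadstat x ^+ 2 <= 76 * N%:R * \sum_x w x.
Proof.
have -> : \sum_x w x * quadstat x ^+ 2 =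
   \sum_j \sum_x w x * (resid x j * (mloc B x j * quadstat x)).
  rewrite exchange_big /=; apply: eq_bigr => x _; rewrite -mulr_sumr; congr (_ * _).
  rewrite expr2 {1}/quadstat mulr_suml; apply: eq_bigr => j _; ring.
have fj x j : mloc B (flip x j) j = mloc B x j.
  by apply/eqP; rewrite eq_sym -subr_eq0 mloc_flip B_diag mul0r mulr0.
apply: (@le_trans _ _ (\sum_j \sum_x w x * (`|mloc B x j| * `|quadstat x - quadstat (flip x j)|))).
  apply: ler_sum => j _; rewrite resid_ibp ler_pdivrMl // mulr_sumr.
  apply: ler_sum => x _; apply: le_trans (ler_norm _) _.
  rewrite fj -mulrBr normrM (ger0_norm (edge_ge0 _ _)) !normrM spin_norm mul1r mulrA.
  by rewrite -mulrA (mulrA 2) ler_wpM2r ?mulr_ge0 // edge_le.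
rewrite exchange_big mulr_sumr; apply: ler_sum => x _.
rewrite -mulr_sumr mulrC ler_wpM2r //.
set S := \sum_j mloc B x j ^+ 2.
have S4 : S <= 4 * N%:R := sum_mloc_sqr x.
apply: (@le_trans _ _ (\sum_j (\sum_k influence j k * (`|mloc B x j| * `|mloc B x k|) +
   (mloc B x j ^+ 2 + (\sum_k B j k * resid x k) ^+ 2) + 8 * (1 + mloc B x j ^+ 2)))).
  apply: ler_sum => j _.
  apply: le_trans (ler_wpM2l (normr_ge0 _) (quadstat_diff x j)) _.
  have mulrDDr (p q r s : R) : p * (q + r + s) = p * q + p * r + p * s by ring.
  rewrite mulrDDr; apply: lerD; last first.
    have := sqr_ge0 (`|mloc B x j| - 1); rewrite sqrrB real_normK ?num_real //; lra.
  apply: lerD; first by rewrite mulr_sumr; apply: ler_sum => k _; rewrite mulrCA.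
  set y := \sum_k _.
  have := sqr_ge0 (`|mloc B x j| - `|y|); rewrite sqrrB !real_normK ?num_real //; lra.
rewrite !big_split /= -!mulr_sumr big_split /= -/S.
have h1 := schur_test (mloc B x) influence_ge0 influence_row influence_col.
rewrite -/S in h1.
have h2 := B_op (resid x).
have h3 : \sum_k resid x k ^+ 2 <= 4 * N%:R.
  rewrite mulr_natr -[X in _ *+ X](card_ord N) -sumr_const; apply: ler_sum => k _.
  have := resid_le2 x k; rewrite ler_norml => /andP[? ?].
  have : 0 <= (2 - resid x k) * (2 + resid x k) by rewrite mulr_ge0; lra.
  lra.
(* The Schur term gives [16 N], the term with [B g] gives [4 N + 16 N], and the constant term gives
   [8 N + 32 N]; together [76 N]. *)
rewrite sumr_const card_ord; lra.
Qed.

Lemma quadstat_tail (u : R) : 0 < u ->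
  \sum_(x | u <= `|quadstat x|) w x <= 76 * N%:R / u ^+ 2 * \sum_x w x.
Proof.
move=> u0; have u2 : 0 < u ^+ 2 by rewrite exprn_gt0.
rewrite mulrAC ler_pdivlMr //; apply: le_trans quadstat_second_moment.
rewrite [X in _ <= X](bigID (fun x => u <= `|quadstat x|)) /= -[X in X <= _]addr0.
apply: lerD; last by apply: sumr_ge0 => x _; rewrite mulr_ge0 // sqr_ge0.
rewrite mulr_suml; apply: ler_sum => x ux; rewrite ler_wpM2l //.
by rewrite -[X in _ <= X]real_normK ?num_real // lerXn2r ?nnegrE // ltW.
Qed.

End QuadraticStatistic.
End Glauber.

(** * Projections, traces and the Rayleigh quotient *)

Section Euclid.
Variable R : realType.

Definition dot n (u v : 'cV[R]_n) : R := \sum_i u i 0 * v i 0.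

Definition sqn n (v : 'cV[R]_n) : R := dot v v.

Lemma dotE n (u v : 'cV[R]_n) : dot u v = (u^T *m v) 0 0.
Proof. by rewrite mxE; apply: eq_bigr => i _; rewrite mxE. Qed.

Lemma dotC n (u v : 'cV[R]_n) : dot u v = dot v u.
Proof. by apply: eq_bigr => i _; rewrite mulrC. Qed.

Lemma dotDr n (u v w : 'cV[R]_n) : dot u (v + w) = dot u v + dot u w.
Proof. by rewrite !dotE mulmxDr mxE. Qed.

Lemma dotBr n (u v w : 'cV[R]_n) : dot u (v - w) = dot u v - dot u w.
Proof. by rewrite !dotE mulmxBr !mxE. Qed.

Lemma dotZr n a (u v : 'cV[R]_n) : dot u (a *: v) = a * dot u v.
Proof. by rewrite !dotE -scalemxAr mxE. Qed.

Lemma dotBl n (u v w : 'cV[R]_n) : dot (u - v) w = dot u w - dot v w.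
Proof. by rewrite dotC dotBr !(dotC w). Qed.

Lemma dotZl n a (u v : 'cV[R]_n) : dot (a *: u) v = a * dot u v.
Proof. by rewrite dotC dotZr dotC. Qed.

Lemma dot_adjoint m n (A : 'M[R]_(m, n)) u v : dot u (A *m v) = dot (A^T *m u) v.
Proof. by rewrite !dotE trmx_mul trmxK mulmxA. Qed.

Lemma sqn_sum n (v : 'cV[R]_n) : sqn v = \sum_i v i 0 ^+ 2.
Proof. by apply: eq_bigr => i _; rewrite expr2. Qed.

Lemma sqn_ge0 n (v : 'cV[R]_n) : 0 <= sqn v.
Proof. by rewrite sqn_sum sumr_ge0 // => i _; rewrite sqr_ge0. Qed.

Lemma sqn_eq0 n (v : 'cV[R]_n) : sqn v = 0 -> v = 0.
Proof.
move/eqP; rewrite sqn_sum psumr_eq0 => [/allP h|i _]; last exact: sqr_ge0.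
apply/matrixP => i j; rewrite ord1 !mxE; apply/eqP.
by have := h i (mem_index_enum _); rewrite /= sqrf_eq0.
Qed.

Lemma sqnB n (u v : 'cV[R]_n) : sqn (u - v) = sqn u - 2 * dot u v + sqn v.
Proof.
rewrite /sqn dotBr (dotC (u - v)) (dotC (u - v)) !dotBr (dotC v u); ring.
Qed.

Lemma sqnD n (u v : 'cV[R]_n) : sqn (u + v) = sqn u + 2 * dot u v + sqn v.
Proof.
rewrite /sqn dotDr (dotC (u + v)) (dotC (u + v)) !dotDr (dotC v u); ring.
Qed.

Lemma sqnZ n a (v : 'cV[R]_n) : sqn (a *: v) = a ^+ 2 * sqn v.
Proof. rewrite /sqn dotZr dotC dotZr; ring. Qed.

Lemma cauchy_schwarz n (u v : 'cV[R]_n) : dot u v ^+ 2 <= sqn u * sqn v.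
Proof.
have [/sqn_eq0 ->|v0] := eqVneq (sqn v) 0.
  have -> : dot u 0 = 0 by rewrite -(scale0r 0) dotZr mul0r.
  by rewrite expr0n /= mulr_ge0 ?sqn_ge0.
have vp : 0 < sqn v by rewrite lt_neqAle eq_sym v0 sqn_ge0.
have := sqn_ge0 (sqn v *: u - dot u v *: v).
rewrite sqnB !sqnZ dotC !dotZr dotC dotZr.
have -> : sqn v ^+ 2 * sqn u - 2 * (sqn v * (dot u v * dot u v)) + dot u v ^+ 2 * sqn v =
  sqn v * (sqn u * sqn v - dot u v ^+ 2) by ring.
by rewrite pmulr_rge0 // subr_ge0.
Qed.

Lemma sqn_delta n (j : 'I_n) : sqn (delta_mx j 0 : 'cV[R]_n) = 1.
Proof.
rewrite sqn_sum (bigD1 j) //= mxE !eqxx big1 ?addr0 ?expr1n // => i /negPf ij.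
by rewrite mxE ij /= expr0n.
Qed.

Lemma dot_delta n (j : 'I_n) (v : 'cV[R]_n) : dot (delta_mx j 0) v = v j 0.
Proof.
rewrite /dot (bigD1 j) //= mxE !eqxx mul1r big1 ?addr0 // => i /negPf ij.
by rewrite mxE ij mul0r.
Qed.

Definition contraction m n (T : 'M[R]_(m, n)) := forall v, sqn (T *m v) <= sqn v.

Lemma contraction_mul m n p (S : 'M[R]_(m, n)) (T : 'M[R]_(n, p)) :
  contraction S -> contraction T -> contraction (S *m T).
Proof. by move=> hS hT v; rewrite -mulmxA; exact: le_trans (hS _) (hT _). Qed.

Lemma coord_sqr_le n (v : 'cV[R]_n) j : v j 0 ^+ 2 <= sqn v.
Proof.
rewrite sqn_sum (bigD1 j) //= lerDl sumr_ge0 // => i _; exact: sqr_ge0.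
Qed.

Lemma contraction_entry m n (T : 'M[R]_(m, n)) j k : contraction T -> `|T j k| <= 1.
Proof.
move=> hT; rewrite -[_ <= 1](@ler_pXn2r _ 2) ?nnegrE // expr1n real_normK ?num_real //.
have := le_trans (coord_sqr_le (T *m delta_mx k 0) j) (hT _).
by rewrite -colE mxE sqn_delta.
Qed.

Lemma trace_gram m n (X : 'M[R]_(m, n)) : \tr (X^T *m X) = \sum_k sqn (X *m delta_mx k 0).
Proof.
apply: eq_bigr => k _; rewrite -colE sqn_sum mxE; apply: eq_bigr => i _.
by rewrite !mxE expr2.
Qed.

Lemma trace_gramC m n (X : 'M[R]_(m, n)) : \tr (X^T *m X) = \sum_i \sum_j X i j ^+ 2.
Proof.
rewrite mxtrace_mulC; apply: eq_bigr => i _; rewrite mxE; apply: eq_bigr => j _.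
by rewrite mxE expr2.
Qed.

(** Here [|A v|^2] is the quadratic form of [A^T A], whose entries are dominated by [e], the matrix
    [|A|^T |A|], with row and column sums at most 1; the Schur test applies. *)
Lemma sym_row_contraction n (A : 'M[R]_n) : A^T = A ->
  (forall i, \sum_j `|A i j| <= 1) -> contraction A.
Proof.
move=> As Ar v.
have Ac j : \sum_i `|A i j| <= 1.
  by apply: le_trans (Ar j); apply: ler_sum => i _; rewrite -{1}As mxE.
pose e (j k : 'I_n) : R := \sum_i `|A i j| * `|A i k|.
have e0 j k : 0 <= e j k by apply: sumr_ge0 => i _; rewrite mulr_ge0.
have er j : \sum_k e j k <= 1.
  rewrite exchange_big /=; apply: le_trans (Ac j); apply: ler_sum => i _.
  by rewrite -mulr_sumr -[X in _ <= X]mulr1 ler_wpM2l.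
have ec k : \sum_j e j k <= 1.
  by apply: le_trans (er k); apply: ler_sum => j _; apply: ler_sum => i _; rewrite mulrC.
have := schur_test (fun j => v j 0) e0 er ec; rewrite mul1r -sqn_sum; apply: le_trans.
rewrite sqn_sum.
have -> : \sum_i (A *m v) i 0 ^+ 2 = \sum_j \sum_k (\sum_i A i j * A i k) * (v j 0 * v k 0).
  under [RHS]eq_bigr => j _.
    under eq_bigr => k _ do rewrite mulr_suml.
    rewrite exchange_big; over.
  rewrite [RHS]exchange_big /=; apply: eq_bigr => i _.
  rewrite mxE expr2 mulr_suml; apply: eq_bigr => j _.
  rewrite mulr_sumr; apply: eq_bigr => k _; ring.
apply: ler_sum => j _; apply: ler_sum => k _.
apply: le_trans (ler_norm _) _; rewrite normrM normrM ler_wpM2r ?mulr_ge0 //.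
by apply: le_trans (ler_norm_sum _ _ _) _; apply: ler_sum => i _; rewrite normrM.
Qed.

(** The witness is the hat matrix [Z (Z^T Z)^-1 Z^T]; its trace is found by cyclicity. *)
Lemma projection_exists m n (Z : 'M[R]_(m, n)) : Z^T *m Z \in unitmx ->
  exists P : 'M[R]_m, [/\ P^T = P, P *m P = P, P *m Z = Z & \tr P = n%:R].
Proof.
move=> Gu; set G := Z^T *m Z in Gu *.
have Gs : G^T = G by rewrite /G trmx_mul trmxK.
exists (Z *m invmx G *m Z^T); split.
- by rewrite !trmx_mul trmxK trmx_inv Gs mulmxA.
- by rewrite !mulmxA -(mulmxA (Z *m _) Z^T) -/G mulmxKV.
- by rewrite -!mulmxA -/G mulVmx // mulmx1.
- by rewrite -mulmxA mxtrace_mulC -mulmxA -/G mulVmx // mxtrace1.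
Qed.

Lemma projection_contraction n (P : 'M[R]_n) : P^T = P -> P *m P = P -> contraction P.
Proof.
move=> Ps PP v.
have E : dot v (P *m v) = sqn (P *m v) by rewrite /sqn [RHS]dot_adjoint mulmxA Ps PP dotC.
have := sqn_ge0 (v - P *m v); rewrite sqnB E; lra.
Qed.

(* [B = A (1 - P) A] is tested against the residuals: [(1 - P) A g] is orthogonal
   to the columns of [Z], so [g^T B x] only sees [A x] modulo these columns. *)
Lemma design_matrix N d (A : 'M[R]_N) (Z : 'M[R]_(N, d)) :
  A^T = A -> contraction A -> Z^T *m Z \in unitmx ->
  exists B : 'M[R]_N, [/\ B^T = B, contraction B, forall j, 0 <= B j j,
   \sum_i \sum_j A i j ^+ 2 - d%:R <= \tr B &
   forall g x v, dot g (B *m x) ^+ 2 <= sqn g * sqn (A *m x + Z *m v)].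
Proof.
move=> As Ac /projection_exists [P [Ps PP PZ Pt]].
set Q := 1%:M - P.
have Qs : Q^T = Q by rewrite /Q linearB /= trmx1 Ps.
have QQ : Q *m Q = Q.
  by rewrite /Q mulmxBr mulmx1 mulmxBl mul1mx PP subrr subr0.
have QZ : Q *m Z = 0 by rewrite /Q mulmxBl mul1mx PZ subrr.
have Qc : contraction Q := projection_contraction Qs QQ.
have Bc : contraction (A *m Q *m A) by do !apply: contraction_mul.
exists (A *m Q *m A); split => //.
- by rewrite !trmx_mul As Qs mulmxA.
- move=> j; have -> : (A *m Q *m A) j j = sqn (Q *m A *m delta_mx j 0).
    rewrite /sqn [RHS]dot_adjoint trmx_mul Qs As !mulmxA -(mulmxA A Q Q) QQ.
    by rewrite dotC dot_delta -colE [RHS]mxE.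
  exact: sqn_ge0.
(* The projection costs [tr (A P A) = ||A P||_F^2 <= ||P||_F^2 = tr P = d], since [A] is a
   contraction. *)
- have -> : A *m Q *m A = A *m A - A *m P *m A.
    by rewrite /Q mulmxBr mulmx1 mulmxBl.
  rewrite linearB /=.
  have -> : \tr (A *m A) = \sum_i \sum_j A i j ^+ 2 by rewrite -{1}As trace_gramC.
  rewrite lerD2l lerN2.
  have -> : \tr (A *m P *m A) = \tr ((A *m P)^T *m (A *m P)).
    by rewrite trmx_mul As Ps [RHS]mxtrace_mulC mulmxA -(mulmxA A P P) PP.
  have -> : d%:R = \tr (P^T *m P) by rewrite Ps PP Pt.
  rewrite !trace_gram.
  by apply: ler_sum => k _; rewrite -mulmxA.
move=> g x v.
have -> : dot g (A *m Q *m A *m x) = dot (Q *m (A *m g)) (A *m x + Z *m v).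
  rewrite dotDr [X in _ + X]dot_adjoint.
  have -> : Z^T *m (Q *m (A *m g)) = 0.
    by rewrite mulmxA -Qs -trmx_mul QZ trmx0 mul0mx.
  have -> : dot 0 v = 0 by rewrite dotC -(scale0r 0) dotZr mul0r.
  by rewrite addr0 -!mulmxA dot_adjoint As dot_adjoint Qs.
apply: le_trans (cauchy_schwarz _ _) _; rewrite ler_wpM2r ?sqn_ge0 //.
exact: le_trans (Qc _) (Ac _).
Qed.

End Euclid.

(** * The smallest eigenvalue as the minimum of the Rayleigh quotient *)

Section LambdaMin.
Variables (R : realType) (n : nat) (S : 'M[R]_n).

Let q (v : 'cV[R]_n) : R := dot v (S *m v).

Lemma quad_continuous : continuous (fun v : 'rV[R]_n => q v^T).
Proof.
have -> : (fun v : 'rV[R]_n => q v^T) = (fun v => \sum_i \sum_j v 0 i * (S i j * v 0 j)).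
  apply/funext => v; apply: eq_bigr => i _; rewrite !mxE mulr_sumr.
  by apply: eq_bigr => j _; rewrite mxE.
apply: continuous_big => [|i _]; first exact: add_continuous.
apply: continuous_big => [|j _ v]; first exact: add_continuous.
have coordc k : {for v, continuous (fun x : 'rV[R]_n => x 0 k)} := @coord_continuous _ _ _ 0 k v.
apply: (@continuousM _ _ (fun x : 'rV[R]_n => x 0 i) (fun x : 'rV[R]_n => S i j * x 0 j)) => //.
by apply: (@continuousM _ _ (fun=> S i j) (fun x : 'rV[R]_n => x 0 j)) => //; exact: cst_continuous.
Qed.

End LambdaMin.

Section Rayleigh.
Variable R : realType.

Lemma sqn_tr_continuous n : continuous (fun v : 'rV[R]_n => sqn v^T).
Proof.
have -> : (fun v : 'rV[R]_n => sqn v^T) = (fun v => dot v^T (1%:M *m v^T)).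
  by apply/funext => v; rewrite mul1mx.
exact: quad_continuous.
Qed.

Lemma sphere_compact n : compact [set v : 'rV[R]_n | sqn v^T = 1]%classic.
Proof.
apply: bounded_closed_compact.
  exists 1; split => // M M1 v /= v1.
  rewrite /Num.norm /= mx_normrE; apply: bigmax_le => [|[i j] _ /=]; first lra.
  rewrite ord1; apply: le_trans (ltW M1).
  rewrite -[_ <= 1](@ler_pXn2r _ 2) ?nnegrE // expr1n real_normK ?num_real // -v1.
  by have := coord_sqr_le v^T j; rewrite mxE.
have -> : [set v : 'rV[R]_n | sqn v^T = 1]%classic = ((fun v : 'rV[R]_n => sqn v^T) @^-1` [set 1])%classic by [].
apply: closed_comp; last exact: closed_eq.
by move=> v _; exact: sqn_tr_continuous.
Qed.

(** The quadratic form attains its minimum [mu] on the compact unit sphere, at some [y]. If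
    [r = S y - mu y] were nonzero, a small step from [y] along [- r] would lower the quotient. So
    [mu] is an eigenvalue and [lambda_min S <= mu]. *)
Lemma lambda_min_rayleigh n (S : 'M[R]_n) (kappa : R) : (0 < n)%N -> S^T = S ->
  kappa <= lambda_min S -> forall v, kappa * sqn v <= dot v (S *m v).
Proof.
case: n S => // n S _ Ss kl.
pose A := [set v : 'rV[R]_n.+1 | sqn v^T = 1]%classic.
have A0 : A !=set0%classic.
  by exists (delta_mx 0 0); rewrite /A /= trmx_delta sqn_delta.
have cf : {within A, continuous (fun v : 'rV[R]_n.+1 => dot v^T (S *m v^T))}%classic.
  apply: continuous_subspaceT; exact: quad_continuous.
have [u uA um] := EVT_min_rV A0 (@sphere_compact n.+1) cf.
move: uA; rewrite inE /A /= => u1.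
set y := u^T in u1 um; set mu := dot y (S *m y) in um.
have min v : mu * sqn v <= dot v (S *m v).
  have [/sqn_eq0 ->|v0] := eqVneq (sqn v) 0.
    by rewrite mulmx0 /sqn -(scale0r 0) !dotZr !mul0r mulr0.
  have vp : 0 < sqn v by rewrite lt_neqAle eq_sym v0 sqn_ge0.
  pose c := (Num.sqrt (sqn v))^-1.
  have c2 : c ^+ 2 = (sqn v)^-1 by rewrite exprVn sqr_sqrtr // ltW.
  have := um (c *: v)^T; rewrite inE /A /= trmxK sqnZ c2 mulVf // => /(_ erefl).
  rewrite -scalemxAr dotZr dotC dotZr mulrA -expr2 c2 dotC.
  by rewrite -ler_pdivrMl ?invr_gt0 // invrK mulrC.
have ev : S *m y = mu *: y.
  apply/eqP; rewrite -subr_eq0; apply/eqP; apply: sqn_eq0; set r := _ - _.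
  set s := sqn r; set c := dot r (S *m r) - mu * s.
  have c0 : 0 <= c by rewrite /c subr_ge0; exact: min.
  apply/eqP; rewrite eq_le sqn_ge0 andbT leNgt; apply/negP => s0.
  (* The gain [2 t s] is linear in [t] and the loss [t^2 c] quadratic; dividing by [c + 1] also
     covers [c = 0]. *)
  set t := s / (c + 1).
  have c1 : 0 < c + 1 by lra.
  have := min (y - t *: r).
  rewrite sqnB sqnZ mulmxBr -scalemxAr !(dotBl, dotBr) !(dotZl, dotZr).
  have E1 : dot y (S *m r) = dot r (S *m y) by rewrite dot_adjoint Ss dotC.
  have E2 : dot r (S *m y) - mu * dot r y = s by rewrite /s /sqn {3}/r dotBr dotZr.
  rewrite E1 (dotC y r) -/mu u1 -/s.
  have E3 : dot r (S *m r) = c + mu * s by rewrite /c; ring.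
  have E4 : dot r (S *m y) = s + mu * dot r y by rewrite -E2; ring.
  rewrite E3 E4 => h.
  have h2 : 0 <= - 2 * t * s + t ^+ 2 * c by lra.
  have h3 : - 2 * t * s + t ^+ 2 * c = (s / (c + 1)) ^+ 2 * (- c - 2).
    by rewrite /t; field; rewrite lt0r_neq0.
  have : (s / (c + 1)) ^+ 2 * (- c - 2) < 0.
    by rewrite pmulr_rlt0 ?exprn_gt0 ?divr_gt0 //; lra.
  lra.
move=> v; apply: le_trans (min v); rewrite ler_wpM2r ?sqn_ge0 //.
(* An infimum lies below a member only for a set bounded below; [mu] is such a bound, by [min] at
   eigenvectors. *)
apply: le_trans kl _; rewrite /lambda_min; apply: ge_inf.
  exists mu => a /= /eigenvalueP [z zS z0].
  have zt : S *m z^T = a *: z^T by rewrite -[S]Ss -trmx_mul zS linearZ.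
  have := min z^T; rewrite zt dotZr -/(sqn _) ler_pM2r // lt_neqAle sqn_ge0 andbT eq_sym.
  by apply: contra z0 => /eqP /sqn_eq0 /(congr1 trmx); rewrite trmxK trmx0 => ->.
apply/eigenvalueP; exists y^T.
  by rewrite -[S]Ss -trmx_mul ev linearZ.
apply/eqP => /(congr1 trmx); rewrite trmxK trmx0 => y0.
by move: u1; rewrite y0 /sqn -(scale0r 0) dotZr mul0r => /eqP; rewrite eq_sym oner_eq0.
Qed.

End Rayleigh.

(** * The Ising model and the penalized pseudolikelihood *)

Section Ising.
Variables (R : realType) (N d : nat) (A : 'M[R]_N) (Z : 'M[R]_(N, d)).
Variables (beta : R) (theta : 'I_d -> R).

Local Notation sp x i := (spin R (x i)).
Local Notation w := (ising_weight A Z beta theta).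

(** The local field at site [i]. When [A] has zero diagonal, its hyperbolic tangent is the
    conditional mean of spin [i] given the other spins. *)
Definition eta (x : config N) (i : 'I_N) : R := beta * mloc A x i + lin_pred Z theta i.
Definition tau x i : R := tanhR (eta x i).
Local Notation g := (resid tau).

Lemma ising_weight_gt0 x : 0 < w x.
Proof. exact: expR_gt0. Qed.

Lemma ising_weight_sum_gt0 : 0 < \sum_x w x.
Proof.
rewrite (bigD1 [ffun=> true]) //= ltr_pwDl ?ising_weight_gt0 //.
by apply: sumr_ge0 => x _; rewrite ltW // ising_weight_gt0.
Qed.

Lemma tau_norm_le1 x i : `|tau x i| <= 1.
Proof. by rewrite ltW // tanhR_norm_lt1. Qed.

Lemma expR_tanhR (t : R) : expR (2 * t) * (1 - tanhR t) = 1 + tanhR t.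
Proof.
rewrite one_subr_tanhR one_addr_tanhR mulrA; congr (_ / _).
by rewrite mulrCA -expRD; congr (_ * expR _); ring.
Qed.

Lemma spin_tanhR (b : bool) t : spin R b * tanhR t = tanhR (spin R b * t).
Proof. by case: b; rewrite /spin ?mul1r // !mulN1r tanhRN. Qed.

Hypothesis A_sym : A^T = A.
Hypothesis A_diag : forall i, A i i = 0.
Hypothesis A_row : forall i, \sum_j `|A i j| <= 1.
Hypothesis beta_small : `|beta| <= 4^-1.

Lemma A_symE i j : A i j = A j i.
Proof. by rewrite -{1}A_sym mxE. Qed.

Lemma mloc_flip_diag x i : mloc A (flip x i) i = mloc A x i.
Proof. by apply/eqP; rewrite eq_sym -subr_eq0 mloc_flip A_diag mul0r mulr0. Qed.

Lemma tau_flip_diag x i : tau (flip x i) i = tau x i.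
Proof. by rewrite /tau /eta mloc_flip_diag. Qed.

(** Spin [i] enters the quadratic form through row [i] and through column [i], each changing by
    [2 x_i m_i]. *)
Lemma ising_quad_flip (x : config N) i :
  \sum_k sp x k * mloc A x k - \sum_k spin R (flip x i k) * mloc A (flip x i) k =
  4 * (sp x i * mloc A x i).
Proof.
have E k : sp x k * mloc A x k - spin R (flip x i k) * mloc A (flip x i) k =
   2 * sp x i * (A i k * sp x k) + (k == i)%:R * (2 * (sp x i * mloc A x i)).
  have := mloc_flip A x i k; rewrite [flip x i k]ffunE; case: eqP => [->|_] h.
    by rewrite mloc_flip_diag spinN A_diag mulr1n; ring.
  rewrite (A_symE i k).
  have -> : mloc A (flip x i) k = mloc A x k - 2 * (A k i * sp x i) by rewrite -h; ring.
  by rewrite mulr0n; ring.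
rewrite -sumrB (eq_bigr _ (fun k _ => E k)) big_split /= -mulr_sumr -/(mloc A x i).
rewrite (bigD1 i) //= eqxx big1 => [|k /negPf->]; last by rewrite mul0r.
by rewrite mulr1n; ring.
Qed.

(** The flip changes the weight by the factor [exp (2 x_i eta_i)], which is the odds
    [(1 + x_i tau_i) / (1 - x_i tau_i)]. *)
Lemma ising_balance (x : config N) i :
  w x * (1 - sp x i * tau x i) = w (flip x i) * (1 + sp x i * tau x i).
Proof.
have -> : w x = w (flip x i) * expR (2 * (sp x i * eta x i)).
  rewrite /ising_weight -expRD; congr expR.
  have Q (y : config N) : \sum_k \sum_j sp y k * A k j * sp y j = \sum_k sp y k * mloc A y k.
    by apply: eq_bigr => k _; rewrite mulr_sumr; apply: eq_bigr => j _; rewrite mulrA.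
  rewrite !Q; have := ising_quad_flip x i.
  have L : \sum_k sp x k * lin_pred Z theta k =
      \sum_k spin R (flip x i k) * lin_pred Z theta k + 2 * (sp x i * lin_pred Z theta i).
    rewrite (bigD1 i) //= [in RHS](bigD1 i) //= spin_flip.
    rewrite (eq_bigr (fun k => spin R (flip x i k) * lin_pred Z theta k)); first by ring.
    by move=> k /negPf ki; rewrite ffunE ki.
  rewrite L /eta; set a := \sum_k _ * mloc A x k; set b := \sum_k _ * mloc _ (flip x i) k => h.
  have -> : a = b + 4 * (sp x i * mloc A x i) by rewrite -h; ring.
  by field.
by rewrite -mulrA /tau spin_tanhR expR_tanhR.
Qed.

(** Makes [|A|], with row and column sums at most 1, the matrix [a] of the abstract spin system. *)
Lemma tau_diff x j k : `|tau x k - tau (flip x j) k| <= 2 * `|A k j|.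
Proof.
apply: le_trans (tanhR_lip _ _) _.
have -> : eta x k - eta (flip x j) k = 2 * beta * (A k j * sp x j).
  by rewrite -[RHS]mulrA mulrCA -mloc_flip /eta; ring.
rewrite !normrM spin_norm mulr1 (ger0_norm (ler0n _ 2)).
have := ler_wpM2r (normr_ge0 (A k j)) beta_small; lra.
Qed.

Lemma absA_col k : \sum_j `|A j k| <= 1.
Proof. by apply: le_trans (A_row k); apply: ler_sum => j _; rewrite A_symE. Qed.

Lemma mloc_norm_le x i : `|mloc A x i| <= 1.
Proof.
apply: le_trans (ler_norm_sum _ _ _) _; apply: le_trans (A_row i).
by apply: ler_sum => j _; rewrite normrM spin_norm mulr1.
Qed.

Lemma ising_quadstat_tail (B : 'M[R]_N) (u : R) :
  B^T = B -> (forall j, B j j = 0) -> (forall j k, `|B j k| <= 2) ->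
  (forall v : 'I_N -> R, \sum_j (\sum_k B j k * v k) ^+ 2 <= 4 * \sum_k v k ^+ 2) -> 0 < u ->
  \sum_(x | u <= `|quadstat tau B x|) w x <= 76 * N%:R / u ^+ 2 * \sum_x w x.
Proof.
move=> Bs Bd Bl Bo u0.
apply: (@quadstat_tail R N w tau (fun j k => `|A j k|)) => //.
- by move=> x; exact: ltW (ising_weight_gt0 x).
- exact: tau_norm_le1.
- exact: tau_flip_diag.
- exact: ising_balance.
- exact: absA_col.
- exact: tau_diff.
- by move=> j k; rewrite -{1}Bs mxE.
Qed.

Lemma ising_linstat_tail (z : 'I_N -> R) (M u : R) :
  (forall i, `|z i| <= M) -> 0 < M -> (0 < N)%N -> 0 <= u ->
  \sum_(x | u <= `|linstat tau z x|) w x <=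
  2 * expR (- (u ^+ 2 / (16 * M ^+ 2 * N%:R))) * \sum_x w x.
Proof.
move=> zM M0 N0 u0.
have tail z' : (forall i, `|z' i| <= M) ->
    \sum_(x | u <= linstat tau z' x) w x <=
    expR (- (u ^+ 2 / (16 * M ^+ 2 * N%:R))) * \sum_x w x.
  move=> z'M; apply: (@linstat_tail R N w tau (fun j k => `|A j k|)) => //.
  - by move=> x; exact: ltW (ising_weight_gt0 x).
  - exact: tau_norm_le1.
  - exact: tau_flip_diag.
  - exact: ising_balance.
  - exact: absA_col.
  - exact: tau_diff.
  - exact: ltW.
have t1 := tail z zM.
have t2 : \sum_(x | u <= linstat tau (fun i => - z i) x) w x <=
    expR (- (u ^+ 2 / (16 * M ^+ 2 * N%:R))) * \sum_x w x.
  by apply: tail => i; rewrite normrN.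
apply: (@le_trans _ _ (\sum_(x | u <= linstat tau z x) w x + \sum_(x | u <= linstat tau (fun i => - z i) x) w x)); last by lra.
rewrite big_mkcond [X in _ <= X + _]big_mkcond [X in _ <= _ + X]big_mkcond -big_split /=.
apply: ler_sum => x _.
have w0 := ltW (ising_weight_gt0 x).
have EN : linstat tau (fun i => - z i) x = - linstat tau z x.
  by rewrite /linstat -sumrN; apply: eq_bigr => i _; rewrite mulNr.
case: ifP => [|_]; last by do 2 case: ifP => _; lra.
rewrite EN; set y := linstat tau z x.
by case: (ger0P y) => _ ->; case: ifP => _; lra.
Qed.

(** Coordinatewise decomposability of the l1 norm: the error counts with sign plus on the support of
    the truth and minus off it. *)
Lemma l1_drop (a b : R) : `|a| - `|b| <= (2 * (a != 0)%:R - 1) * `|b - a|.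
Proof.
case: eqP => [->|_] /=.
  by rewrite normr0 subr0 mulr0n mulr0; lra.
have := ler_normB b (b - a); rewrite opprB addrC subrK mulr1n; lra.
Qed.

(** The minimizer is compared with the true parameter. The loss is affine plus a sum of [ln cosh],
    so its increment is exactly a Bregman sum minus the residuals paired with [h]. *)
Lemma pl_estimator_basic (x : config N) (lambda bh : R) (th : 'I_d -> R) (h : 'I_N -> R) :
  (forall i, h i = (bh - beta) * mloc A x i + lin_pred Z (fun k => th k - theta k) i) ->
  is_pl_estimator A Z x lambda bh th ->
  N%:R^-1 * \sum_i lncosh_bregman (eta x i) (h i) <=
  N%:R^-1 * \sum_i g x i * h i + lambda * (l1norm beta theta - l1norm bh th).
Proof.
move=> hdef est; have := est beta theta; rewrite /pl_loss.
have hE i : bh * mloc A x i + lin_pred Z th i = eta x i + h i.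
  rewrite /eta hdef /lin_pred.
  have -> : \sum_k th k * Z i k = \sum_k theta k * Z i k + \sum_k (th k - theta k) * Z i k.
    by rewrite -big_split; apply: eq_bigr => k _ /=; ring.
  ring.
under eq_bigr => i _ do rewrite hE.
rewrite -/(eta x _).
set S1 := \sum_i _; set S2 := \sum_i _ => le.
have E : \sum_i lncosh_bregman (eta x i) (h i) = \sum_i g x i * h i - S1 + S2.
  rewrite /S1 /S2 -sumrB -big_split /=; apply: eq_bigr => i _.
  rewrite /lncosh_bregman /resid /tau -/(eta x i); ring.
rewrite E; set T := \sum_i _; set c := N%:R^-1 in le *.
have -> : c * (T - S1 + S2) = c * T - c * S1 + c * S2 by ring.
lra.
Qed.

Lemma sqr_le_l2norm (b : R) (t : 'I_d -> R) :
  `|b| <= l2norm b t /\ forall k, `|t k| <= l2norm b t.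
Proof.
have S0 : 0 <= \sum_k t k ^+ 2 by apply: sumr_ge0 => k _; exact: sqr_ge0.
rewrite /l2norm; split => [|k]; rewrite -sqrtr_sqr ler_wsqrtr //; first by rewrite lerDl.
rewrite (bigD1 k) //= addrCA lerDl addr_ge0 ?sqr_ge0 // sumr_ge0 // => i _; exact: sqr_ge0.
Qed.

(** Each coordinate is bounded by the full l2 norm, giving [s] in place of its square root; this is
    harmless for bounded [s]. *)
Lemma support_l1_le (u : R) (v : 'I_d -> R) (s : nat) : (l0norm beta theta <= s)%N ->
  (beta != 0)%:R * `|u| + \sum_k (theta k != 0)%:R * `|v k| <= s%:R * l2norm u v.
Proof.
move=> ls; have [ub vb] := sqr_le_l2norm u v.
have r0 : 0 <= l2norm u v by rewrite sqrtr_ge0.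
apply: (@le_trans _ _ ((l0norm beta theta)%:R * l2norm u v)); last by rewrite ler_wpM2r // ler_nat.
rewrite /l0norm natrD mulrDl lerD // ?ler_wpM2l ?ler0n //.
rewrite -sum1_card natr_sum mulr_suml big_mkcond [X in _ <= X]big_mkcond /=.
by apply: ler_sum => k _; rewrite inE; case: (theta k != 0); rewrite /= ?mul1r ?mul0r.
Qed.

(** The deterministic core: with gradient coordinates at most [lambda / 2], the error norm [r]
    satisfies [c kappa r^2 / (1 + K r) <= 2 lambda s r], and small [lambda] absorbs the denominator
    whatever the size of [r]. *)
Lemma pl_estimator_bound (x : config N) (lambda bh : R) (th : 'I_d -> R)
  (s : nat) (M q kappa : R) :
  (0 < N)%N -> 0 < lambda -> 0 <= M -> 0 < q -> q <= 1 -> 0 < kappa ->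
  (l0norm beta theta <= s)%N ->
  (forall i k, `|Z i k| <= M) ->
  (forall i, 2 * q <= 1 - `|tau x i|) ->
  (forall k, `|linstat tau (fun i => Z i k) x| <= N%:R * lambda / 2) ->
  `|quadstat tau A x| <= N%:R * lambda / 2 ->
  (forall (u : R) (v : 'I_d -> R), kappa * N%:R * (u ^+ 2 + \sum_k v k ^+ 2) <=
     \sum_i (u * mloc A x i + lin_pred Z v i) ^+ 2) ->
  16 * lambda * s%:R ^+ 2 * (1 + M) <= q ^+ 3 / 2 * kappa ->
  is_pl_estimator A Z x lambda bh th ->
  l2norm (bh - beta) (fun k => th k - theta k) <= 8 * s%:R / (q ^+ 3 * kappa) * lambda.
Proof.
move=> N0 lp M0 q0 q1 k0 ls ZM gap gradT gradB design lsmall est.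
have N1 : 0 < N%:R :> R by rewrite ltr0n.
have l0 := ltW lp.
set u := bh - beta; set v := fun k => th k - theta k.
pose h i := u * mloc A x i + lin_pred Z v i.
have := @pl_estimator_basic x lambda bh th h (fun=> erefl) est.
set SD := \sum_i lncosh_bregman _ _.
set r := l2norm u v.
have r0 : 0 <= r by rewrite sqrtr_ge0.
set l1 := l1norm u v.
have gh : \sum_i g x i * h i <= N%:R * lambda / 2 * l1.
  have -> : \sum_i g x i * h i = u * quadstat tau A x + \sum_k v k * linstat tau (fun i => Z i k) x.
    rewrite /quadstat /linstat mulr_sumr.
    under [X in _ = _ + X]eq_bigr => k _ do rewrite mulr_sumr.
    rewrite exchange_big -big_split /=; apply: eq_bigr => i _.
    rewrite /h /lin_pred; move: (mloc A x i) => y; rewrite mulrDr mulr_sumr; congr (_ + _); first by rewrite mulrCA.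
    by apply: eq_bigr => k _; ring.
  rewrite /l1 /l1norm mulrDr; apply: lerD.
    by apply: le_trans (ler_norm _) _; rewrite normrM mulrC ler_wpM2r.
  rewrite mulr_sumr; apply: ler_sum => k _.
  by apply: le_trans (ler_norm _) _; rewrite normrM mulrC ler_wpM2r.
set P := (beta != 0)%:R * `|u| + \sum_k (theta k != 0)%:R * `|v k|.
have Ps : P <= s%:R * r := support_l1_le u v ls.
have drop : l1norm beta theta - l1norm bh th <= 2 * P - l1.
  have -> : 2 * P - l1 = (2 * (beta != 0)%:R - 1) * `|u| + \sum_k (2 * (theta k != 0)%:R - 1) * `|v k|.
    rewrite /P /l1 /l1norm.
    have -> : \sum_k (2 * (theta k != 0)%:R - 1) * `|v k| =
       2 * (\sum_k (theta k != 0)%:R * `|v k|) - \sum_k `|v k|.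
      by rewrite mulr_sumr -sumrB; apply: eq_bigr => k _; ring.
    ring.
  rewrite /l1norm opprD addrACA -sumrB; apply: lerD; first exact: l1_drop.
  by apply: ler_sum => k _; exact: l1_drop.
have gh' : N%:R^-1 * \sum_i g x i * h i <= lambda / 2 * l1.
  by rewrite ler_pdivrMl // !mulrA.
move=> basic.
have SD0 : 0 <= N%:R^-1 * SD.
  by rewrite mulr_ge0 ?invr_ge0 ?ler0n // sumr_ge0 // => i _; exact: lncosh_bregman_ge0.
have ld := ler_wpM2l l0 drop.
have lP := ler_wpM2l l0 Ps.
have l10 : 0 <= l1 by rewrite addr_ge0 // sumr_ge0.
have ub : N%:R^-1 * SD <= 2 * lambda * s%:R * r by have := mulr_ge0 l0 l10; lra.
(* Nonnegativity of the Bregman sum in the basic inequality gives [0 <= lambda (2 P - l1 / 2)]. *)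
have cone : l1 <= 4 * s%:R * r.
  have : lambda * l1 <= lambda * (4 * s%:R * r) by lra.
  by rewrite ler_pM2l.
set K := 4 * s%:R * (1 + M).
have K0 : 0 <= K by rewrite !mulr_ge0 ?ler0n ?addr_ge0.
have hK i : `|h i| <= K * r.
  apply: (@le_trans _ _ ((1 + M) * l1)); last first.
    have := ler_wpM2l (addr_ge0 ler01 M0) cone; rewrite /K; lra.
  rewrite /l1 /l1norm mulrDr; apply: le_trans (ler_normD _ _) _; apply: lerD.
    rewrite normrM mulrC ler_wpM2r //; have := mloc_norm_le x i; lra.
  rewrite mulr_sumr; apply: le_trans (ler_norm_sum _ _ _) _; apply: ler_sum => k _.
  rewrite normrM mulrC ler_wpM2r //; have := ZM i k; lra.
set c := q ^+ 3 / 2.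
have c0 : 0 < c by rewrite divr_gt0 ?exprn_gt0.
have Kr : 0 < 1 + K * r by rewrite ltr_pwDl // mulr_ge0.
have lb : c * kappa * r ^+ 2 / (1 + K * r) <= N%:R^-1 * SD.
  rewrite ler_pdivlMl //.
  apply: (@le_trans _ _ (\sum_i c * (h i ^+ 2 / (1 + K * r)))).
    rewrite -mulr_sumr -mulr_suml.
    have -> : N%:R * (c * kappa * r ^+ 2 / (1 + K * r)) =
      c * (kappa * N%:R * r ^+ 2 / (1 + K * r)) by ring.
    rewrite ler_pM2l // ler_pM2r ?invr_gt0 // /r /l2norm sqr_sqrtr; first exact: design.
    by rewrite addr_ge0 ?sqr_ge0 // sumr_ge0 // => k _; exact: sqr_ge0.
  apply: ler_sum => i _; apply: le_trans (lncosh_bregman_lower _ (ltW q0) q1 (gap i)).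
  have hp : 0 < 1 + `|h i| by rewrite ltr_pwDl.
  by rewrite -/c ler_pM2l // ler_wpM2l ?sqr_ge0 // lef_pV2 ?posrE // lerD2l hK.
have key : c * kappa * r ^+ 2 <= 2 * lambda * s%:R * r * (1 + K * r).
  by rewrite -ler_pdivrMr //; exact: le_trans lb ub.
have [r1|r1] := eqVneq r 0.
  by rewrite r1 !mulr_ge0 ?invr_ge0 ?mulr_ge0 ?ler0n ?exprn_ge0 // ltW.
have rp : 0 < r by rewrite lt_neqAle eq_sym r1.
have key2 : c * kappa * r <= 2 * lambda * s%:R * (1 + K * r).
  rewrite -(ler_pM2r rp); lra.
(* Half of the curvature pays for the term that comes from [K r]. *)
have small : 2 * lambda * s%:R * K * r <= c * kappa / 2 * r.
  rewrite ler_wpM2r // /K; move: lsmall; rewrite -/c => ?; lra.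
have fin : c * kappa * r <= 4 * lambda * s%:R by lra.
have ck : 0 < c * kappa by rewrite mulr_gt0.
have -> : 8 * s%:R / (q ^+ 3 * kappa) * lambda = (c * kappa)^-1 * (4 * lambda * s%:R).
  by rewrite /c; field; rewrite !lt0r_neq0 ?exprn_gt0.
by rewrite ler_pdivlMl.
Qed.

End Ising.

(** * The design on a likely event *)

Section Gram.
Variables (R : realType) (N d : nat) (Z : 'M[R]_(N, d)) (kappaZ : R).
Hypotheses (N_gt0 : (0 < N)%N) (d_gt0 : (0 < d)%N) (kappaZ_gt0 : 0 < kappaZ).
Hypothesis gramZ : kappaZ <= lambda_min (N%:R^-1 *: (Z^T *m Z)).

Lemma gram_lower (v : 'cV[R]_d) : kappaZ * N%:R * sqn v <= sqn (Z *m v).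
Proof.
have Ss : (N%:R^-1 *: (Z^T *m Z))^T = N%:R^-1 *: (Z^T *m Z).
  by rewrite linearZ /= trmx_mul trmxK.
have := lambda_min_rayleigh d_gt0 Ss gramZ v.
rewrite -scalemxAl dotZr -mulmxA dot_adjoint trmxK => h.
have N0 : 0 < N%:R :> R by rewrite ltr0n.
have -> : kappaZ * N%:R * sqn v = N%:R * (kappaZ * sqn v) by ring.
by rewrite -ler_pdivlMl.
Qed.

Lemma gram_unit : Z^T *m Z \in unitmx.
Proof.
rewrite -row_free_unit; apply: inj_row_free => v vG.
have : sqn (Z *m v^T) = 0.
  by rewrite /sqn dotE trmx_mul trmxK mulmxA -(mulmxA v) vG mul0mx mxE.
have := gram_lower v^T => + z; rewrite z.
rewrite pmulr_rle0; last by rewrite mulr_gt0 // ltr0n.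
move=> v0; have /sqn_eq0 /(congr1 trmx) : sqn v^T = 0.
  by apply/eqP; rewrite eq_le v0 sqn_ge0.
by rewrite trmxK trmx0.
Qed.

End Gram.

Section OffDiagonal.
Variables (R : realType) (N : nat) (B : 'M[R]_N).

(** Integration by parts needs a zero diagonal; the removed diagonal is handled by its sign in
    [mloc_dist_lower]. *)
Definition offdiag : 'M[R]_N := \matrix_(i, j) (if i == j then 0 else B i j).

Lemma offdiag_diag j : offdiag j j = 0.
Proof. by rewrite mxE eqxx. Qed.

Lemma offdiag_sym : B^T = B -> offdiag^T = offdiag.
Proof.
move=> Bs; apply/matrixP => i j; rewrite !mxE eq_sym; case: eqP => // _.
by rewrite -{1}Bs mxE.
Qed.

Lemma contraction_fun (T : 'M[R]_N) (v : 'I_N -> R) : contraction T ->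
  \sum_j (\sum_k T j k * v k) ^+ 2 <= \sum_k v k ^+ 2.
Proof.
move=> /(_ (\col_k v k)); rewrite !sqn_sum.
have -> : \sum_i (\col_k v k) i 0 ^+ 2 = \sum_k v k ^+ 2.
  by apply: eq_bigr => k _; rewrite mxE.
apply: le_trans; rewrite le_eqVlt; apply/orP; left; apply/eqP.
apply: eq_bigr => j _; rewrite mxE; congr (_ ^+ 2).
by apply: eq_bigr => k _; rewrite mxE.
Qed.

Hypothesis Bc : contraction B.

Lemma offdiag_entry j k : `|offdiag j k| <= 2.
Proof.
rewrite mxE; case: eqP => _; first by rewrite normr0.
by apply: le_trans (contraction_entry j k Bc) _; lra.
Qed.

(** Both [B] and its diagonal part are contractions, so their difference has operator norm at most
    2. *)
Lemma offdiag_op (v : 'I_N -> R) :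
  \sum_j (\sum_k offdiag j k * v k) ^+ 2 <= 4 * \sum_k v k ^+ 2.
Proof.
have E j : \sum_k offdiag j k * v k = \sum_k B j k * v k - B j j * v j.
  rewrite (bigD1 j) //= offdiag_diag mul0r add0r [in RHS](bigD1 j) //= addrAC subrr add0r.
  by apply: eq_bigr => k kj; rewrite mxE eq_sym (negPf kj).
have -> : 4 * \sum_k v k ^+ 2 = 2 * \sum_k v k ^+ 2 + 2 * \sum_k v k ^+ 2 by ring.
apply: (@le_trans _ _ (2 * \sum_j (\sum_k B j k * v k) ^+ 2 + 2 * \sum_j v j ^+ 2)); last first.
  by rewrite lerD2r ler_pM2l // contraction_fun.
rewrite !mulr_sumr -big_split /=; apply: ler_sum => j _; rewrite E.
set y := \sum_k _.
have := sqr_ge0 (y + B j j * v j).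
have : (B j j * v j) ^+ 2 <= v j ^+ 2.
  rewrite exprMn -[X in _ <= X]mul1r ler_wpM2r ?sqr_ge0 //.
  by rewrite -[B j j ^+ 2]real_normK ?num_real // expr_le1 // contraction_entry.
lra.
Qed.

End OffDiagonal.

Section UnionBound.
Variables (R : realType) (T : finType) (w : T -> R).
Hypothesis w_ge0 : forall x, 0 <= w x.

Lemma sum_or_le (P Q : pred T) :
  \sum_(x | P x || Q x) w x <= \sum_(x | P x) w x + \sum_(x | Q x) w x.
Proof.
rewrite big_mkcond [X in _ <= X + _]big_mkcond [X in _ <= _ + X]big_mkcond -big_split /=.
apply: ler_sum => x _; have := w_ge0 x.
by case: (P x); case: (Q x) => /=; lra.
Qed.

Lemma sum_exists_le (K : finType) (P : K -> pred T) :
  \sum_(x | [exists k, P k x]) w x <= \sum_k \sum_(x | P k x) w x.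
Proof.
under [X in _ <= X]eq_bigr => k _ do rewrite big_mkcond.
rewrite exchange_big big_mkcond /=; apply: ler_sum => x _.
case: ifP => [/existsP [k Pk]|_]; last by apply: sumr_ge0 => k _; case: ifP.
rewrite (bigD1 k) //= Pk lerDl; apply: sumr_ge0 => j _; by case: ifP.
Qed.

End UnionBound.

(** * Finite-sample probability bound for the estimator *)

Section Consistency.
Variables (R : realType) (N d : nat) (A : 'M[R]_N) (Z : 'M[R]_(N, d)).
Variables (beta : R) (theta : 'I_d -> R) (M q kappaA kappaZ : R) (s : nat).

Local Notation w := (ising_weight A Z beta theta).
Local Notation tau := (tau A Z beta theta).

Lemma ising_prob_le1 (E : config N -> Prop) : ising_prob A Z beta theta E <= 1.
Proof.
rewrite /ising_prob ler_pdivrMr ?ising_weight_sum_gt0 // mul1r.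
rewrite [X in _ <= X](bigID (fun x => `[< E x >])) /= lerDl.
by apply: sumr_ge0 => x _; rewrite ltW // ising_weight_gt0.
Qed.

Lemma ising_prob_lower (E : config N -> Prop) (bad : pred (config N)) (p : R) :
  (forall x, ~~ bad x -> E x) -> \sum_(x | bad x) w x <= p * \sum_x w x ->
  1 - p <= ising_prob A Z beta theta E.
Proof.
move=> goodE hp; rewrite /ising_prob ler_pdivlMr ?ising_weight_sum_gt0 //.
rewrite mulrBl mul1r lerBlDr.
apply: (@le_trans _ _ (\sum_(x | `[< E x >]) w x + \sum_(x | bad x) w x)); last by rewrite lerD2l.
rewrite [X in X <= _](bigID (fun x => `[< E x >])) /= lerD2l.
rewrite big_mkcond [X in _ <= X]big_mkcond; apply: ler_sum => x _.
have := ltW (ising_weight_gt0 A Z beta theta x).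
case: ifP => [/negP nE|_] w0; last by case: ifP.
by case: ifPn => // /goodE Ex; case: nE; apply/asboolP.
Qed.

(* Combines [q^2 kappaA^2 / 16 <= dist(m, col Z)^2 / N] with [kappaZ |v|^2 <= |Z v|^2 / N]. *)
Definition design_const : R :=
  ((q ^+ 2 * kappaA ^+ 2 / 16)^-1 + (2 + 2 / (q ^+ 2 * kappaA ^+ 2 / 16)) / kappaZ)^-1.

Hypotheses (N_gt0 : (0 < N)%N) (d_gt0 : (0 < d)%N).
Hypotheses (M_gt0 : 0 < M) (kappaA_gt0 : 0 < kappaA) (kappaZ_gt0 : 0 < kappaZ).
Hypotheses (q_gt0 : 0 < q) (q_le1 : q <= 1).
Hypothesis A_sym : A^T = A.
Hypothesis A_diag : forall i, A i i = 0.
Hypothesis A_row : forall i, \sum_j `|A i j| <= 1.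
Hypothesis beta_small : `|beta| <= 4^-1.
Hypothesis sparse : (l0norm beta theta <= s)%N.
Hypothesis Z_le : forall i k, `|Z i k| <= M.
Hypothesis gap : forall x i, 2 * q <= 1 - `|tau x i|.
Hypothesis A_frob : kappaA * N%:R <= \sum_i \sum_j A i j ^+ 2.
Hypothesis gramZ : kappaZ <= lambda_min (N%:R^-1 *: (Z^T *m Z)).
Hypothesis d_small : d%:R <= kappaA * N%:R / 2.

Lemma design_const_gt0 : 0 < design_const.
Proof.
have c1 : 0 < q ^+ 2 * kappaA ^+ 2 / 16 by rewrite divr_gt0 // mulr_gt0 ?exprn_gt0.
by rewrite invr_gt0 addr_gt0 ?invr_gt0 // divr_gt0 // addr_gt0 // divr_gt0.
Qed.

Section DesignEvent.
Variables (B : 'M[R]_N) (x : config N).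
Hypothesis B_diag_ge0 : forall j, 0 <= B j j.
Hypothesis B_trace : \sum_i \sum_j A i j ^+ 2 - d%:R <= \tr B.
Hypothesis B_test : forall g y v,
  dot g (B *m y) ^+ 2 <= sqn g * sqn (A *m y + Z *m v).
Hypothesis B_event : `|quadstat tau (offdiag B) x| <= q * kappaA * N%:R / 2.

Let gc : 'cV[R]_N := \col_i resid tau x i.
Let xc : 'cV[R]_N := \col_i spin R (x i).

(** On the diagonal, [g_j x_j = 1 - x_j tau_j] because [x_j^2 = 1]. *)
Lemma dot_resid_quad :
  dot gc (B *m xc) = \sum_j B j j * (1 - spin R (x j) * tau x j) + quadstat tau (offdiag B) x.
Proof.
rewrite /quadstat -big_split /=; apply: eq_bigr => j _.
rewrite /gc /xc !mxE /mloc (bigD1 j) //= [in RHS](bigD1 j) //= offdiag_diag mul0r add0r mulrDr.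
congr (_ + _).
  rewrite mxE /resid mulrCA mulrBl spin_sqr; congr (_ * (_ - _)); exact: mulrC.
congr (_ * _); apply: eq_bigr => k kj; by rewrite !mxE eq_sym (negPf kj).
Qed.

(** The diagonal part is at least [2 q tr B >= q kappaA N], and the event removes at most half of
    it. Testing against the residuals, with [|g|^2 <= 4 N], turns this into a distance. *)
Lemma mloc_dist_lower (v : 'cV[R]_d) :
  q ^+ 2 * kappaA ^+ 2 / 16 * N%:R <= sqn (A *m xc + Z *m v).
Proof.
have N0 : 0 < N%:R :> R by rewrite ltr0n.
have lb : q * kappaA * N%:R / 2 <= dot gc (B *m xc).
  rewrite dot_resid_quad.
  have : 2 * q * \tr B <= \sum_j B j j * (1 - spin R (x j) * tau x j).
    rewrite /mxtrace mulr_sumr; apply: ler_sum => j _; rewrite mulrC ler_wpM2l //.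
    apply: le_trans (gap x j) _; rewrite lerD2l lerN2.
    by apply: le_trans (ler_norm _) _; rewrite normrM spin_norm mul1r.
  have : 2 * q * (kappaA * N%:R / 2) <= 2 * q * \tr B.
    by rewrite ler_pM2l ?mulr_gt0 //; have := A_frob; have := B_trace; have := d_small; lra.
  have := B_event; rewrite ler_norml => /andP[]; lra.
have p0 : 0 <= q * kappaA * N%:R / 2 by rewrite divr_ge0 ?mulr_ge0 ?ltW.
have gN : sqn gc <= 4 * N%:R.
  rewrite sqn_sum mulr_natr -[X in _ *+ X](card_ord N) -sumr_const; apply: ler_sum => k _.
  rewrite mxE -[_ ^+ 2]real_normK ?num_real //.
  have := resid_le2 (tau_norm_le1 A Z beta theta) x k; have := normr_ge0 (resid tau x k).
  set y := `|_| => y0 y2; have : 0 <= (2 - y) * (2 + y) by rewrite mulr_ge0; lra.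
  lra.
have := B_test gc xc v.
have : (q * kappaA * N%:R / 2) ^+ 2 <= dot gc (B *m xc) ^+ 2.
  by rewrite lerXn2r ?nnegrE // (le_trans p0).
have := ler_wpM2r (sqn_ge0 (A *m xc + Z *m v)) gN.
set Y := sqn (A *m xc + Z *m v) => h1 h2 h3.
have h : N%:R * (q ^+ 2 * kappaA ^+ 2 / 16 * N%:R) <= N%:R * Y.
  have -> : N%:R * (q ^+ 2 * kappaA ^+ 2 / 16 * N%:R) = (q * kappaA * N%:R / 2) ^+ 2 / 4 by field.
  lra.
by rewrite ler_pM2l in h.
Qed.

Lemma design_lower (u : R) (v : 'I_d -> R) :
  design_const * N%:R * (u ^+ 2 + \sum_k v k ^+ 2) <=
  \sum_i (u * mloc A x i + lin_pred Z v i) ^+ 2.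
Proof.
have N0 : 0 < N%:R :> R by rewrite ltr0n.
pose vc : 'cV[R]_d := \col_k v k.
have -> : \sum_k v k ^+ 2 = sqn vc by rewrite sqn_sum; apply: eq_bigr => k _; rewrite mxE.
have -> : \sum_i (u * mloc A x i + lin_pred Z v i) ^+ 2 = sqn (u *: (A *m xc) + Z *m vc).
  rewrite sqn_sum; apply: eq_bigr => i _; rewrite !mxE; congr ((_ * _ + _) ^+ 2).
    by apply: eq_bigr => j _; rewrite mxE.
  by apply: eq_bigr => j _; rewrite mxE mulrC.
set Y := sqn (u *: _ + _); set c1 := q ^+ 2 * kappaA ^+ 2 / 16.
have c10 : 0 < c1 by rewrite divr_gt0 // mulr_gt0 ?exprn_gt0.
have hu : c1 * N%:R * u ^+ 2 <= Y.
  have [->|u0] := eqVneq u 0; first by rewrite expr0n /= mulr0 sqn_ge0.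
  have -> : Y = u ^+ 2 * sqn (A *m xc + Z *m (u^-1 *: vc)).
    by rewrite -sqnZ scalerDr -scalemxAr scalerA divff // scale1r.
  by rewrite mulrC ler_wpM2l ?sqr_ge0 // mloc_dist_lower.
have hx : sqn (A *m xc) <= N%:R.
  apply: le_trans (sym_row_contraction A_sym A_row _) _.
  rewrite sqn_sum; under eq_bigr => i _ do rewrite mxE expr2 spin_sqr.
  by rewrite sumr_const card_ord.
(* The vector [Z v] is the full combination minus [u m], where [|m|^2 <= N]; the remaining [N u^2]
   is controlled by [hu]. *)
have hv : kappaZ * N%:R * sqn vc <= 2 * Y + 2 * (N%:R * u ^+ 2).
  apply: le_trans (gram_lower N_gt0 d_gt0 gramZ vc) _.
  have -> : Z *m vc = (u *: (A *m xc) + Z *m vc) - u *: (A *m xc) by rewrite addrAC subrr add0r.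
  have P (a b : 'cV[R]_N) : sqn (a - b) <= 2 * sqn a + 2 * sqn b.
    by have := sqn_ge0 (a + b); rewrite sqnB sqnD; lra.
  apply: le_trans (P _ _) _; rewrite lerD2l ler_pM2l // sqnZ mulrC.
  by rewrite ler_wpM2r ?sqr_ge0.
rewrite /design_const -/c1 -!mulrA ler_pdivrMl; last first.
  by rewrite addr_gt0 ?invr_gt0 // divr_gt0 // addr_gt0 // divr_gt0.
have hu' : N%:R * u ^+ 2 <= Y / c1 by rewrite ler_pdivlMr //; lra.
have hv' : N%:R * sqn vc <= (2 * Y + 2 * (Y / c1)) / kappaZ by rewrite ler_pdivlMr //; lra.
have -> : (c1^-1 + (2 + 2 / c1) / kappaZ) * Y = Y / c1 + (2 * Y + 2 * (Y / c1)) / kappaZ by ring.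
lra.
Qed.

End DesignEvent.

Lemma pl_estimator_prob (lambda : R) : 0 < lambda ->
  16 * lambda * s%:R ^+ 2 * (1 + M) <= q ^+ 3 / 2 * design_const ->
  1 - (d%:R * (2 * expR (- ((N%:R * lambda / 2) ^+ 2 / (16 * M ^+ 2 * N%:R))))
       + 76 * N%:R / (N%:R * lambda / 2) ^+ 2
       + 76 * N%:R / (q * kappaA * N%:R / 2) ^+ 2) <=
  ising_prob A Z beta theta (fun x => forall bh th,
    is_pl_estimator A Z x lambda bh th ->
    l2norm (bh - beta) (fun k => th k - theta k) <= 8 * s%:R / (q ^+ 3 * design_const) * lambda).
Proof.
move=> lam0 lsmall.
have N0 : 0 < N%:R :> R by rewrite ltr0n.
have Ac := sym_row_contraction A_sym A_row.
have [B [Bs Bc Bd Bt Btest]] := design_matrix A_sym Ac (gram_unit N_gt0 d_gt0 kappaZ_gt0 gramZ).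
set u1 := N%:R * lambda / 2; set u3 := q * kappaA * N%:R / 2.
have u10 : 0 < u1 by rewrite divr_gt0 // mulr_gt0.
have u30 : 0 < u3 by rewrite divr_gt0 // !mulr_gt0.
(* The bad events are a large [theta]-gradient, a large [beta]-gradient, and a degenerate design. *)
pose bad (x : config N) := [exists k, u1 <= `|linstat tau (fun i => Z i k) x|]
   || (u1 <= `|quadstat tau A x|) || (u3 <= `|quadstat tau (offdiag B) x|).
apply: (@ising_prob_lower _ bad).
  move=> x; rewrite /bad !negb_or -!ltNge => /andP[/andP[/existsPn g1 /ltW g2] /ltW g3] bh th.
  apply: (@pl_estimator_bound R N d A Z beta theta A_row x lambda bh th s M q design_const) => //.
  - exact: ltW.
  - exact: design_const_gt0.
  - by move=> k; apply: ltW; rewrite ltNge; exact: g1.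
  - exact: (@design_lower B x).
have w0 x := ltW (ising_weight_gt0 A Z beta theta x).
apply: le_trans (sum_or_le w0 _ _) _; rewrite mulrDl; apply: lerD; last first.
  apply: ising_quadstat_tail => //; [exact: offdiag_sym|exact: offdiag_diag|exact: offdiag_entry|exact: offdiag_op].
apply: le_trans (sum_or_le w0 _ _) _; rewrite mulrDl; apply: lerD; last first.
  apply: ising_quadstat_tail => //.
    by move=> j k; apply: le_trans (contraction_entry j k Ac) _; lra.
  move=> v; apply: le_trans (contraction_fun v Ac) _.
  by rewrite ler_peMl ?sumr_ge0 // => [k _|]; [exact: sqr_ge0|lra].
apply: le_trans (sum_exists_le w0 _) _.
rewrite -mulrA mulr_natl -[X in _ *+ X](card_ord d) -sumr_const.
by apply: ler_sum => k _; apply: ising_linstat_tail => //; exact: ltW.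
Qed.

End Consistency.

(** * Rates *)

(** At most [s] coordinates of [theta] are nonzero, so the local field is at most [1 + s Theta M]
    whatever [d] is. *)
Lemma tau_gap (R : realType) (N d : nat) (A : 'M[R]_N) (Z : 'M[R]_(N, d)) (beta : R)
  (theta : 'I_d -> R) (M Theta : R) (s : nat) :
  0 <= M -> 0 <= Theta -> (forall i, \sum_j `|A i j| <= 1) -> `|beta| <= 1 ->
  (l0norm beta theta <= s)%N -> (forall k, `|theta k| <= Theta) -> (forall i k, `|Z i k| <= M) ->
  forall x i, expR (- (2 * (1 + s%:R * (Theta * M)))) <= 1 - `|tau A Z beta theta x i|.
Proof.
move=> M0 T0 Ar b1 ls tT ZM x i; apply: tanhR_gap.
apply: le_trans (ler_normD _ _) _; apply: lerD.
  by rewrite normrM mulr_ile1 // mloc_norm_le.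
apply: le_trans (ler_norm_sum _ _ _) _.
apply: (@le_trans _ _ (\sum_(k < d) (theta k != 0)%:R * (Theta * M))).
  apply: ler_sum => k _; rewrite normrM; case: eqP => [->|_] /=.
    by rewrite normr0 !mul0r.
  by rewrite mul1r ler_pM.
rewrite -mulr_suml ler_wpM2r ?mulr_ge0 // -natr_sum ler_nat.
apply: leq_trans ls; rewrite /l0norm -sum1_card big_mkcond /=.
rewrite [X in (_ <= _ + X)%N]big_mkcond /= (leq_trans _ (leq_addl _ _)) //.
by apply: leq_sum => k _; rewrite inE; case: (theta k != 0).
Qed.

Lemma ising_prob_mono (R : realType) (N d : nat) (A : 'M[R]_N) (Z : 'M[R]_(N, d)) (beta : R)
  (theta : 'I_d -> R) (E F : config N -> Prop) : (forall x, E x -> F x) ->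
  ising_prob A Z beta theta E <= ising_prob A Z beta theta F.
Proof.
move=> EF; rewrite /ising_prob ler_pM2r ?invr_gt0 ?ising_weight_sum_gt0 //.
rewrite big_mkcond [X in _ <= X]big_mkcond; apply: ler_sum => x _.
have := ltW (ising_weight_gt0 A Z beta theta x).
case: asboolP => [/EF Fx|_]; first by case: asboolP.
by case: ifP.
Qed.

Section Rates.
Variable R : realType.

Lemma ln_half_le (d : nat) : (2 <= d)%N -> 2^-1 <= ln (d%:R : R).
Proof.
move=> d2; have d2' : 2 <= d%:R :> R by rewrite (ler_nat R 2 d).
have x0 : 0 <= d%:R - 1 :> R by lra.
have := ln1D_lower x0.
have -> : 1 + (d%:R - 1) = d%:R :> R by ring.
apply: le_trans; rewrite ler_pdivlMr; lra.
Qed.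

Lemma ln_succ_le (d : nat) : (2 <= d)%N -> ln (d.+1%:R : R) <= 2 * ln (d%:R : R).
Proof.
move=> d2; have d2' : 2 <= d%:R :> R by rewrite (ler_nat R 2 d).
have -> : 2 * ln (d%:R : R) = ln ((d%:R : R) ^+ 2).
  by rewrite lnXn ?mulr_natl //; lra.
rewrite ler_ln ?posrE ?ltr0n ?exprn_gt0 //; last by lra.
have h : 0 <= (d%:R - 2) * (d%:R + 1) :> R by rewrite mulr_ge0; lra.
rewrite -natr1; lra.
Qed.

(* With [d^2 ln d <= N] everything the finite-sample bound requires of [N] is implied by [d] large. *)
Lemma failure_rate (N d : nat) (M c L u : R) :
  L = ln (d.+1%:R : R) -> u = N%:R * (16 * M * Num.sqrt (L / N%:R)) / 2 -> (2 <= d)%N -> 0 < M -> 0 < c ->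
  d%:R ^+ 2 * ln (d%:R : R) <= N%:R ->
  d%:R * (2 * expR (- (u ^+ 2 / (16 * M ^+ 2 * N%:R)))) + 76 * N%:R / u ^+ 2
    + 76 * N%:R / (c * N%:R) ^+ 2 <= (2 + 2 / M ^+ 2 + 76 / c ^+ 2) / L.
Proof.
move=> LE uE d2 M0 c0 dN.
have d2' : 2 <= d%:R :> R by rewrite (ler_nat R 2 d).
have l0 := ln_half_le d2.
have dd : 2 * d%:R <= (d%:R : R) ^+ 2.
  by have h : 0 <= d%:R * (d%:R - 2) :> R by [rewrite mulr_ge0; lra]; lra.
have Nd : d%:R <= N%:R :> R.
  apply: le_trans dN; have := ler_wpM2l (sqr_ge0 (d%:R : R)) l0; lra.
have N0 : 0 < N%:R :> R by lra.
have L0 : 0 < L by rewrite LE ln_gt0 // ltr1n ltnS ltnW.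
have Ld : L <= d%:R by rewrite LE -nat1r; apply: le_ln1Dx; lra.
have u2 : u ^+ 2 = 64 * M ^+ 2 * N%:R * L.
  rewrite uE expr_div_n !exprMn sqr_sqrtr ?divr_ge0 ?ltW //.
  by field; rewrite lt0r_neq0.
have N1 : N%:R != 0 :> R by rewrite lt0r_neq0.
have M1 : M != 0 by rewrite lt0r_neq0.
have c1 : c != 0 by rewrite lt0r_neq0.
have L1 : L != 0 by rewrite lt0r_neq0.
have -> : (2 + 2 / M ^+ 2 + 76 / c ^+ 2) / L = 2 / L + 2 / M ^+ 2 / L + 76 / c ^+ 2 / L by ring.
rewrite u2; apply: lerD; first apply: lerD.
(* With exponent [4 L], the union over [d <= e^L] coordinates costs one factor [e^L], and one
   remaining [e^(-L)] is at most [1 / L]. *)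
- have -> : 64 * M ^+ 2 * N%:R * L / (16 * M ^+ 2 * N%:R) = 4 * L by field; rewrite N1 M1.
  have e1 : d%:R <= expR L by rewrite LE lnK ?posrE ?ltr0n // ler_nat.
  have e2 : expR (- (4 * L)) = expR (- L) * (expR (- L) * expR (- L) ^+ 2).
    by rewrite expr2 -!expRD; congr expR; ring.
  have e3 : expR L * expR (- L) = 1 by rewrite -expRD subrr expR0.
  have e4 : expR (- L) <= L^-1.
    rewrite expRN lef_pV2 ?posrE ?expR_gt0 //.
    by have := expR_ge1Dx L; lra.
  have en : 0 <= expR (- L) := expR_ge0 _.
  have e5 : expR (- L) <= 1 by rewrite -expR0 ler_expR oppr_le0 ltW.
  apply: (@le_trans _ _ (2 * expR (- L))); last by rewrite ler_pM2l.
  have h1 : expR (- L) * expR (- L) ^+ 2 <= expR (- L).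
    by rewrite ler_piMr // expr_le1.
  have h2 : d%:R * expR (- L) <= 1 by apply: (@le_trans _ _ (expR L * expR (- L))); [rewrite ler_wpM2r|rewrite e3].
  rewrite mulrCA ler_pM2l // e2 [X in X <= _]mulrA -[X in _ <= X]mul1r.
  by apply: ler_pM => //; rewrite mulr_ge0 ?ler0n ?sqr_ge0.
- have -> : 76 * N%:R / (64 * M ^+ 2 * N%:R * L) = (76 / 64) / M ^+ 2 / L by field; rewrite N1 M1 L1.
  rewrite ler_pM2r ?invr_gt0 // ler_pM2r ?invr_gt0 ?exprn_gt0 //; lra.
(* This term is of order [1 / N], and [L <= d <= N]. *)
- have -> : 76 * N%:R / (c * N%:R) ^+ 2 = 76 / c ^+ 2 / N%:R by field; rewrite N1 c1.
  by rewrite ler_wpM2l ?divr_ge0 ?exprn_ge0 ?(ltW c0) // lef_pV2 ?posrE //; lra.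
Qed.

(** From [ln (d + 1) <= 2 ln d] and [d^2 ln d <= N] the ratio under the root is at most
    [2 / d^2]. *)
Lemma lambda_small (N d : nat) (t : R) : (2 <= d)%N -> 0 < t -> 2 / t <= d%:R ->
  d%:R ^+ 2 * ln (d%:R : R) <= N%:R -> Num.sqrt (ln (d.+1%:R : R) / N%:R) <= t.
Proof.
move=> d2 t0 td dN.
have d2' : 2 <= d%:R :> R by rewrite (ler_nat R 2 d).
have l0 := ln_half_le d2.
have ls := ln_succ_le d2.
have D0 : 0 < (d%:R : R) ^+ 2 by rewrite exprn_gt0 //; lra.
have N0 : 0 < N%:R :> R.
  apply: lt_le_trans dN; rewrite mulr_gt0 //; lra.
have dt : 2 <= t * d%:R by rewrite mulrC -ler_pdivrMr.
have dt2 : 4 <= t ^+ 2 * d%:R ^+ 2.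
  have h : 0 <= (t * d%:R - 2) * (t * d%:R + 2) by rewrite mulr_ge0; lra.
  have := exprMn 2 t (d%:R : R) => <-; lra.
rewrite -[X in _ <= X]ger0_norm ?(ltW t0) // -sqrtr_sqr ler_wsqrtr // ler_pdivrMr //.
apply: le_trans ls _.
have h1 := ler_wpM2l (sqr_ge0 t) dN.
have h2 : 4 * ln (d%:R : R) <= t ^+ 2 * d%:R ^+ 2 * ln (d%:R : R) by rewrite ler_wpM2r //; lra.
lra.
Qed.

Lemma sqrt_ln_succ (N d : nat) : (2 <= d)%N ->
  Num.sqrt (ln (d.+1%:R : R) / N%:R) <= 2 * Num.sqrt (ln (d%:R : R) / N%:R).
Proof.
move=> d2; have l0 := ln_half_le d2; have ls := ln_succ_le d2.
have -> : 2 = Num.sqrt (2 ^+ 2) :> R by rewrite sqrtr_sqr ger0_norm.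
rewrite -sqrtrM ?sqr_ge0 // ler_wsqrtr // mulrA ler_wpM2r ?invr_ge0 ?ler0n //; lra.
Qed.

End Rates.

Unset Implicit Arguments.

(** The event ranges over all minimizers, so it covers every choice of the argmin. Fixed [kappaA]
    and [kappaZ] witness the positive lower limits. *)
Theorem mainTheorem19 (R : realType) (Theta M beta kappaA kappaZ : R) (s0 : nat) :
  0 < Theta -> 0 < M ->
  `|beta| < 4^-1 ->
  0 < kappaA -> 0 < kappaZ ->
  exists delta eps : R, 0 < delta /\ 0 < eps /\
  forall (d : nat -> nat)
         (A : forall N : nat, 'M[R]_N)
         (Z : forall N : nat, 'M[R]_(N, d N))
         (theta : forall N : nat, 'I_(d N) -> R),
    (* Assumption 1 *)
    (forall N (k : 'I_(d N)), `|theta N k| < Theta) ->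
    (forall N (i : 'I_N) (k : 'I_(d N)), `|Z N i k| < M) ->
    (* Assumption 2 *)
    (forall N, (A N)^T = A N) ->
    (forall N (i : 'I_N), A N i i = 0) ->
    (* Assumption 3 *)
    (forall N (i : 'I_N), \sum_(j < N) `|A N i j| <= 1) ->
    (* Assumption 4: liminf N^-1 ||A||_F^2 > 0 *)
    (\forall N \near \oo,
        kappaA <= (N%:R)^-1 * \sum_(i < N) \sum_(j < N) (A N i j) ^+ 2) ->
    (* Assumption 6: liminf lambda_min(N^-1 Z^T Z) > 0 *)
    (\forall N \near \oo,
        kappaZ <= lambda_min ((N%:R)^-1 *: ((Z N)^T *m Z N))) ->
    (* Assumption 7 *)
    (forall N, (l0norm beta (theta N) <= s0)%N) ->
    (* d -> oo *)
    (forall K : nat, \forall N \near \oo, (K <= d N)%N) ->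
    (* d^2 log d <= eps N *)
    (\forall N \near \oo, (d N)%:R ^+ 2 * ln ((d N)%:R) <= eps * N%:R) ->
    exists C : R,
      (fun N : nat =>
         ising_prob (A N) (Z N) beta (theta N)
           (fun x : config N =>
              forall (bh : R) (th : 'I_(d N) -> R),
                is_pl_estimator (A N) (Z N) x
                  (delta * Num.sqrt (ln ((d N).+1%:R) / N%:R)) bh th ->
                l2norm (bh - beta) (fun k => th k - theta N k)
                  <= C * Num.sqrt (ln ((d N)%:R) / N%:R)))
        @ \oo --> (1 : R).
Proof.
move=> T0 M0 b4 kA0 kZ0.
(* The factor [16 M] produces the exponent [4 ln (d + 1)] in the union bound. With [eps = 1] all
   further smallness comes from [d] tending to infinity. *)
exists (16 * M), 1; split; first by rewrite mulr_gt0.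
split=> // d A Z theta thT ZM As Ad Ar Afrob gram ls dinf dN.
set q : R := expR (- (2 * (1 + s0%:R * (Theta * M)))) / 2.
have q0 : 0 < q by rewrite divr_gt0 // expR_gt0.
have q1 : q <= 1.
  have : expR (- (2 * (1 + s0%:R * (Theta * M)))) <= 1.
    have : 0 <= s0%:R * (Theta * M) by rewrite !mulr_ge0 ?ler0n // ltW.
    by move=> h; rewrite -[X in _ <= X]expR0 ler_expR; lra.
  rewrite /q; lra.
have qE : 2 * q = expR (- (2 * (1 + s0%:R * (Theta * M)))) by rewrite /q; field.
clearbody q.
set kap := design_const q kappaA kappaZ.
have kap0 : 0 < kap by exact: design_const_gt0.
(* The constant of [pl_estimator_bound] times [16 M]; the last 2 replaces [ln (d + 1)] by [ln d]
   under the root. *)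
exists (8 * s0%:R / (q ^+ 3 * kap) * (16 * M * 2)).
have s1 : 0 < s0%:R ^+ 2 + 1 :> R by rewrite ltr_wpDl ?sqr_ge0.
have M1 : 0 < 1 + M by rewrite addr_gt0.
(* The threshold for [sqrt (ln (d + 1) / N)] that makes [lambda] small enough; [s0^2 + 1] keeps the
   denominator positive when [s0 = 0]. *)
set t : R := q ^+ 3 / 2 * kap / (16 * (16 * M) * (s0%:R ^+ 2 + 1) * (1 + M)).
have t0 : 0 < t.
  have c0 : 0 < 16 * (16 * M) * (s0%:R ^+ 2 + 1) * (1 + M).
    by rewrite !mulr_gt0.
  by rewrite divr_gt0 // mulr_gt0 // divr_gt0 ?exprn_gt0.
have qA0 : 0 < q * kappaA / 2 by rewrite divr_gt0 // mulr_gt0.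
set K : R := 2 + 2 / M ^+ 2 + 76 / (q * kappaA / 2) ^+ 2.
have K0 : 0 < K.
  by rewrite !addr_gt0 // divr_gt0 ?exprn_gt0.
apply/cvgrPdist_le => e e0.
have arch (y : R) : exists n : nat, y <= n%:R.
  by exists (Num.bound `|y|); exact: le_trans (ler_norm y) (ltW (archi_boundP (normr_ge0 y))).
(* Three thresholds for [d]: the first gives [d <= kappaA N / 2] through [N >= d^2 / 2], the second
   a small [lambda], the third a failure probability [K / L <= e]. *)
have [n1 hn1] := arch (4 / kappaA).
have [n2 hn2] := arch (2 / t).
have [n3 hn3] := arch (expR (K / e)).
near=> N.
have dD : (n1 + n2 + n3 + 2 <= d N)%N by near: N; exact: dinf.
have d2 : (2 <= d N)%N by exact: leq_trans (leq_addl _ _) dD.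
have dA : 4 / kappaA <= (d N)%:R by apply: le_trans hn1 _; rewrite ler_nat (leq_trans _ dD) // -!addnA leq_addr.
have dt : 2 / t <= (d N)%:R by apply: le_trans hn2 _; rewrite ler_nat (leq_trans _ dD) // (addnC n1) -!addnA leq_addr.
have de : expR (K / e) <= (d N)%:R by apply: le_trans hn3 _; rewrite ler_nat (leq_trans _ dD) // (addnC _ n3) -!addnA leq_addr.
clear hn1 hn2 hn3 dD arch.
have d2' : 2 <= (d N)%:R :> R by rewrite (ler_nat R 2 (d N)).
have dNN : (d N)%:R ^+ 2 * ln ((d N)%:R : R) <= N%:R.
  by rewrite -[X in _ <= X]mul1r; near: N.
have l0 := ln_half_le R d2.
have Nlow : (d N)%:R ^+ 2 / 2 <= N%:R :> R.
  by apply: le_trans dNN; rewrite ler_wpM2l ?sqr_ge0.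
have D0 : 0 < ((d N)%:R : R) ^+ 2 by rewrite exprn_gt0 //; lra.
have N0 : 0 < N%:R :> R by lra.
have N0' : (0 < N)%N by rewrite -(ltr0n R).
have L0 : 0 < ln ((d N).+1%:R : R) by rewrite ln_gt0 // ltr1n ltnS ltnW.
set L := ln ((d N).+1%:R : R) in L0 *.
set lam := 16 * M * Num.sqrt (L / N%:R).
have lam0 : 0 < lam by rewrite !mulr_gt0 // sqrtr_gt0 divr_gt0.
have frob : kappaA * N%:R <= \sum_i \sum_j A N i j ^+ 2.
  rewrite mulrC -ler_pdivlMl //; near: N; exact: Afrob.
have gramN : kappaZ <= lambda_min ((N%:R)^-1 *: ((Z N)^T *m Z N)) by near: N; exact: gram.
have ds : (d N)%:R <= kappaA * N%:R / 2.
  have h : 4 <= (d N)%:R * kappaA by rewrite -ler_pdivrMr.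
  have h2 := ler_wpM2l (ltW kA0) Nlow.
  have h3 : 4 * (d N)%:R <= (d N)%:R * kappaA * (d N)%:R by rewrite ler_wpM2r.
  lra.
have ZMN i k : `|Z N i k| <= M by rewrite ltW.
have gap x i : 2 * q <= 1 - `|tau (A N) (Z N) beta (theta N) x i|.
  rewrite qE; apply: tau_gap => //; try exact: ltW; last by move=> k; rewrite ltW.
  by apply: ltW; apply: lt_trans b4 _; lra.
have lsm : 16 * lam * s0%:R ^+ 2 * (1 + M) <= q ^+ 3 / 2 * kap.
  have st : Num.sqrt (L / N%:R) <= t by apply: lambda_small.
  have c0 : 0 < 16 * (16 * M) * (s0%:R ^+ 2 + 1) * (1 + M).
    by rewrite !mulr_gt0.
  rewrite /t ler_pdivlMr // in st.
  apply: le_trans st; rewrite /lam.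
  have c2 : 0 <= Num.sqrt (L / N%:R) * (16 * (16 * M)) * (1 + M).
    by rewrite mulr_ge0 ?(ltW M1) // mulr_ge0 ?sqrtr_ge0 // !mulr_ge0 // ltW.
  lra.
have P := @pl_estimator_prob R N (d N) (A N) (Z N) beta (theta N) M q kappaA kappaZ s0
   N0' (ltnW d2) M0 kA0 kZ0 q0 q1 (As N) (Ad N) (Ar N) (ltW b4) (ls N) ZMN gap frob gramN ds lam lam0 lsm.
have F := @failure_rate R N (d N) M (q * kappaA / 2) L _ erefl erefl d2 M0 qA0 dNN.
rewrite -/lam -/K in F.
set p := ising_prob _ _ _ _ _.
have p1 : p <= 1 by exact: ising_prob_le1.
rewrite ger0_norm ?subr_ge0 //.
have KL : K / L <= e.
  rewrite ler_pdivrMr // mulrC -ler_pdivrMr //.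
  rewrite -[X in X <= _]expRK /L ler_ln ?posrE ?expR_gt0 ?ltr0n //.
  by apply: le_trans de _; rewrite ler_nat.
have E3 : q * kappaA / 2 * N%:R = q * kappaA * N%:R / 2 by ring.
rewrite E3 in F.
have Pp : ising_prob (A N) (Z N) beta (theta N) (fun x => forall bh th,
    is_pl_estimator (A N) (Z N) x lam bh th ->
    l2norm (bh - beta) (fun k => th k - theta N k) <= 8 * s0%:R / (q ^+ 3 * kap) * lam) <= p.
  apply: ising_prob_mono => x h bh th est; apply: le_trans (h bh th est) _.
  have c0 : 0 <= 8 * s0%:R / (q ^+ 3 * kap) * (16 * M).
    have qk : 0 < q ^+ 3 * kap by rewrite mulr_gt0 ?exprn_gt0.
    apply: mulr_ge0; last by rewrite mulr_ge0 // ltW.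
    by apply: divr_ge0 (ltW qk); rewrite mulr_ge0 ?ler0n.
  have := ler_wpM2l c0 (@sqrt_ln_succ R N (d N) d2); rewrite /lam -/L; lra.
lra.
Unshelve. all: by end_near.
Qed.
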